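(* Let $c$ be a hyperbolic parameter contained in a hyperbolic component $H_c$ of the Mandelbrot set, and let $c_0$ be the center of $H_c$. Then the regular part $\mathcal{R}_c$ is homeomorphic to the regular part $\mathcal{R}_{c_0}$.
   Context: For $c\in\mathbb{C}$ let $f_c(z)=z^2+c$ on the Riemann sphere $\bar{\mathbb{C}}$. A hyperbolic component of the Mandelbrot set is a connected component of the set of parameters $c$ for which $f_c$ has a (super)attracting cycle in $\mathbb{C}$; its center is the unique parameter in it for which the critical point $0$ is periodic. The natural extension is $\mathcal{N}_c=\{\hat z=(z_0,z_{-1},\dots)\in\bar{\mathbb{C}}^{\mathbb{N}} : f_c(z_{-n-1})=z_{-n}\ \forall n\ge 0\}$ with the topology induced by the product topology. Given $\hat z\in\mathcal{N}_c$ and a connected open neighborhood $U_0$ of $z_0$, let $U_{-n}$ be the connected component of $f_c^{-n}(U_0)$ containing $z_{-n}$. The point $\hat z$ is regular if for some such $U_0$ there is $N$ such that $U_{-n}$ contains no critical point of $f_c$ for all $n\ge N$. The regular part $\mathcal{R}_c\subset\mathcal{N}_c$ is the set of regular points with the induced topology. *)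

(* Defs.v *)
From HB Require Import structures.
From mathcomp Require Import all_boot all_order all_algebra.
From mathcomp Require Import complex.
From mathcomp Require Import all_classical all_reals all_analysis.
Import Order.TTheory GRing.Theory Num.Theory.
Import numFieldNormedType.Exports.

Set Implicit Arguments.
Unset Strict Implicit.
Unset Printing Implicit Defensive.

Local Open Scope classical_set_scope.
Local Open Scope ring_scope.

(* The topology of R[i] lives on its regular algebra R[i]^o. *)
Notation Cplx R := (complex R)^o.
Notation sphere R := (one_point_compactification (Cplx R)).

Definition quad (R : realType) (c z : Cplx R) : Cplx R := z ^+ 2 + c.

Definition quad_sphere (R : realType) (c : Cplx R) (x : sphere R) : sphere R :=
  if x is Some z then Some (quad c z) else None.

(* The period [p] need not be minimal: the multiplier along [k] turns of a
   cycle is the [k]-th power of its multiplier. *)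
Definition has_attracting_cycle (R : realType) (c : Cplx R) : Prop :=
  exists (p : nat) (z : Cplx R),
    [/\ (0 < p)%N, iter p (quad c) z = z &
        `|derive1 (iter p (quad c) : complex R -> Cplx R) z| < 1].

Definition hyperbolic_component (R : realType) (H : set (Cplx R)) : Prop :=
  exists2 c, has_attracting_cycle c &
    H = connected_component [set c' | has_attracting_cycle c'] c.

(* A component has only one such parameter, so this determines [c0]. *)
Definition is_center (R : realType) (H : set (Cplx R)) (c0 : Cplx R) : Prop :=
  H c0 /\ exists2 p : nat, (0 < p)%N & iter p (quad c0) 0 = 0.

Definition sphere_inv (R : realType) (x : sphere R) : sphere R :=
  if x is Some z then (if z == 0 then None else Some ((z : complex R)^-1))
  else Some 0.

(* [quad_sphere c] in the chart [1/z] at both ends; the default value of [odflt]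
   is only reached away from a neighborhood of [0]. *)
Definition quad_at_infinity (R : realType) (c w : Cplx R) : Cplx R :=
  odflt 0 (sphere_inv (quad_sphere c (sphere_inv (Some w)))).

Definition critical_point (R : realType) (c : Cplx R) (x : sphere R) : Prop :=
  if x is Some z then derive1 (quad c : complex R -> Cplx R) z = 0
  else derive1 (quad_at_infinity c : complex R -> Cplx R) 0 = 0.

(* [zh n] is the coordinate of index [-n]; [{ptws _ -> _}] is the product
   topology. *)
Definition natural_extension (R : realType) (c : Cplx R) :
    set {ptws nat -> sphere R} :=
  [set zh | forall n, quad_sphere c (zh n.+1) = zh n].

Definition pullback (R : realType) (c : Cplx R) (U0 : set (sphere R))
    (zh : {ptws nat -> sphere R}) (n : nat) : set (sphere R) :=
  connected_component (iter n (quad_sphere c) @^-1` U0) (zh n).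

Definition regular_part (R : realType) (c : Cplx R) :
    set {ptws nat -> sphere R} :=
  [set zh | natural_extension c zh /\
    exists U0 : set (sphere R),
      [/\ open U0, connected U0, U0 (zh 0%N) &
          exists N : nat, forall n, (N <= n)%N ->
            forall x, pullback c U0 zh n x -> ~ critical_point c x]].

Definition homeomorphic (T U : topologicalType) (A : set T) (B : set U) : Prop :=
  exists (f : T -> U) (g : U -> T),
    [/\ set_fun A B f /\ set_fun B A g,
        {within A, continuous f}, {within B, continuous g},
        {in A, cancel f g} & {in B, cancel g f}].

(* Main.v *)
(* Being homeomorphic is an equivalence relation, and a hyperbolic component is
   connected, so it suffices to show that the regular part of [c] does not change
   up to homeomorphism when a parameter [c] with an attracting cycle is perturbed.

   For such a [c] let [W] be the complement of a forward invariant neighbourhood of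
   infinity and of the attracting cycle that contains the critical point 0. (That 0
   is attracted by the cycle is Fatou's theorem: otherwise small discs at the cycle
   lift to bounded discs through all iterates of [quad c], with derivatives that
   blow up, against Schwarz's lemma.) For all parameters near [c], the regular
   points are the backward orbits that eventually lie in [W]: the others are
   infinity and the attracting cycles, and lifting discs again shows that their
   pullbacks meet the critical point.

   Let [kappa x] be the supremum of the derivatives at 0 of the analytic discs in
   [W] centred at [x]. Discs lift through [quad c] into the preimage of [W], which
   is compactly contained in [W], so they can be enlarged by a fixed amount there:
   this makes [quad c] uniformly expanding on [W] for the metric [|dx| / kappa x].
   Interpolate between [quad c1] deep inside [W] and [quad c] near its boundary and
   outside. Expansion gives, for each orbit of [quad c], a unique orbit of the
   interpolated map that shadows it inside [W] and coincides with it outside. The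
   resulting conjugacy is a homeomorphism, and it extends to the natural extensions
   by conjugating far back in a backward orbit and iterating forward. *)

Require Import Defs.
From mathcomp Require Import all_boot all_order all_algebra.
From mathcomp Require Import complex.
From mathcomp Require Import all_classical all_reals all_analysis.
From mathcomp Require Import ring lra zify.
Import Order.TTheory GRing.Theory Num.Theory.
Import numFieldNormedType.Exports.

Set Implicit Arguments.
Unset Strict Implicit.
Unset Printing Implicit Defensive.

Local Open Scope classical_set_scope.
Local Open Scope ring_scope.

(** Nearby quadratic maps need not be conjugate on the plane: a superattracting cycle and a merely
    attracting one already differ near the cycle. This is why the interpolated map keeps [quad c]
    near the boundary of [W] and outside, where the conjugacy can be the identity, and why the
    conjugacy with [quad c1] itself is claimed only at points whose image lies in [W]. A backward
    orbit that has entered [W] keeps its whole tail there, so this restricted equation is enough to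
    transport it. One set [W] has to serve all nearby parameters, hence the slack [eta] and [d0] in
    its defining inequalities.

    On [W] the Euclidean derivative may well be less than 1; expansion is visible only in a metric
    adapted to [W]. Describing that metric by discs reduces it to two facts: a disc avoiding the
    critical value has a square root, which lifts it, and Schwarz's lemma, which makes the supremum
    finite. [kappa] enters only through inequalities, and its continuity is never invoked:
    comparisons at nearby points are made by translating the discs. *)

(* The norm of the library on [R[i]] takes its values in [R[i]]; [nm] is real-valued. *)
Definition nm (R : realType) (z : Cplx R) : R := ComplexField.Normc.normc z.
Definition rc (R : realType) (t : R) : Cplx R := real_complex R t.

(** * The real-valued modulus and bounded sequences of complex numbers *)

Section modulus.
Context {R : realType}.
Implicit Types (x y z : Cplx R) (s t : R).

Lemma normr_nm z : `|z : complex R| = rc (nm z).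
Proof. by case: z. Qed.

Lemma nm_ge0 z : 0 <= nm z.
Proof. by case: z => a b; exact: sqrtr_ge0. Qed.

Lemma nm0 : nm (0 : Cplx R) = 0.
Proof. exact: ComplexField.Normc.normc0. Qed.

Lemma nmM x y : nm (x * y) = nm x * nm y.
Proof. exact: ComplexField.Normc.normcM. Qed.

Lemma nmD x y : nm (x + y) <= nm x + nm y.
Proof. exact: le_normcD. Qed.

Lemma nmN x : nm (- x) = nm x.
Proof. exact: normcN. Qed.

Lemma nm1 : nm (1 : Cplx R) = 1.
Proof. exact: ComplexField.Normc.normc1. Qed.

Lemma nmX x n : nm (x ^+ n) = nm x ^+ n.
Proof. by elim: n => [|n IH]; rewrite ?expr0 ?nm1// !exprS nmM IH. Qed.

Lemma nm_eq0 x : (nm x == 0) = (x == 0).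
Proof.
apply/eqP/eqP => [/ComplexField.Normc.eq0_normc//|->]; exact: nm0.
Qed.

Lemma nm_gt0 x : (0 < nm x) = (x != 0).
Proof. by rewrite lt_neqAle nm_ge0 andbT eq_sym nm_eq0. Qed.

Lemma nmV x : nm x^-1 = (nm x)^-1.
Proof.
have [->|x0] := eqVneq x 0; first by rewrite invr0 nm0 invr0.
have h : nm x * nm x^-1 = 1 by rewrite -nmM divff// nm1.
by apply: (mulfI (x := nm x)); rewrite ?nm_eq0// h divff// nm_eq0.
Qed.

Lemma nm_rc t : nm (rc t) = `|t|.
Proof. by rewrite /nm /rc /= expr0n /= addr0 sqrtr_sqr. Qed.

Lemma nmB x y : nm (x - y) = nm (y - x).
Proof. by rewrite -nmN opprB. Qed.

Lemma nm_triangle y x z : nm (x - z) <= nm (x - y) + nm (y - z).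
Proof. by have := nmD (x - y) (y - z); rewrite addrA subrK. Qed.

Lemma nmB_ge x y : nm x - nm y <= nm (x - y).
Proof. by rewrite lerBlDr; have := nmD (x - y) y; rewrite subrK. Qed.

Lemma nm_le_eq x y : (forall e, 0 < e -> nm (x - y) <= e) -> x = y.
Proof.
move=> h; apply/eqP; rewrite -subr_eq0 -nm_eq0 eq_le nm_ge0 andbT.
by rewrite leNgt; apply/negP => h0; have := h (nm (x - y) / 2); lra.
Qed.

Lemma rcD s t : rc (s + t) = rc s + rc t.
Proof. by rewrite /rc rmorphD. Qed.
Lemma rcN s : rc (- s) = - rc s.
Proof. by rewrite /rc rmorphN. Qed.
Lemma rc0 : rc (0 : R) = 0. Proof. by []. Qed.
Lemma rc1 : rc (1 : R) = 1. Proof. by []. Qed.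
Lemma rc_nat n : rc (n%:R : R) = n%:R.
Proof. by elim: n => [|n IH] //; rewrite -!natr1 rcD IH. Qed.
Lemma nm_sqr z : nm z ^+ 2 = complex.Re z ^+ 2 + complex.Im z ^+ 2.
Proof.
by case: z => a b; rewrite /nm /= sqr_sqrtr// addr_ge0// sqr_ge0.
Qed.

Lemma nm_Re z : `|complex.Re z| <= nm z.
Proof.
rewrite -(@ler_pXn2r _ 2%N) ?nnegrE ?nm_ge0// nm_sqr real_normK ?num_real//.
by rewrite lerDl sqr_ge0.
Qed.

Lemma nm_Im z : `|complex.Im z| <= nm z.
Proof.
rewrite -(@ler_pXn2r _ 2%N) ?nnegrE ?nm_ge0// nm_sqr real_normK ?num_real//.
by rewrite lerDr sqr_ge0.
Qed.

Lemma nm_le_ReIm z : nm z <= `|complex.Re z| + `|complex.Im z|.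
Proof.
rewrite -(@ler_pXn2r _ 2%N) ?nnegrE ?nm_ge0 ?addr_ge0// nm_sqr.
rewrite sqrrD !real_normK ?num_real//.
by have := mulr_ge0 (normr_ge0 (complex.Re z)) (normr_ge0 (complex.Im z)); lra.
Qed.

Lemma nbhs_nm z (A : set (Cplx R)) :
  nbhs z A <-> exists2 e : R, 0 < e & forall y, nm (y - z) < e -> A y.
Proof.
split.
- rewrite -nbhs_ballE => -[e /= e0 h].
  have eE : e = rc (complex.Re e).
    by rewrite [LHS]complexE /= (ger0_Im (ltW e0)) mulr0 addr0.
  exists (complex.Re e); first by move: e0; rewrite eE ltcE /= => /andP[].
  by move=> y yz; apply: h; rewrite -ball_normE /= distrC normr_nm eE ltcR.
- case=> e e0 h; rewrite -nbhs_ballE; exists (rc e); first by rewrite /= ltcR.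
  by move=> y; rewrite -ball_normE /= distrC normr_nm ltcR; exact: h.
Qed.

Lemma open_nm (A : set (Cplx R)) :
  open A <-> forall z, A z -> exists2 e : R, 0 < e & forall y, nm (y - z) < e -> A y.
Proof.
rewrite openE; split=> h z Az; first by apply/nbhs_nm/h.
by apply/nbhs_nm/h.
Qed.

Lemma bolzano_weierstrass (u : nat -> Cplx R) (M : R) : (forall n, nm (u n) <= M) ->
  exists l, forall e, 0 < e -> forall N, exists2 n, (N <= n)%N & nm (u n - l) < e.
Proof.
move=> uM.
pose I := `[(- M), M]%classic : set R.
pose v n := (complex.Re (u n), complex.Im (u n)).
have cK : compact (I `*` I) by apply: compact_setX; exact: segment_compact.
have vI : (v @ \oo) (I `*` I).
  exists 0%N => // n _; split; rewrite /= /I /= in_itv /= -ler_norml.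
  - exact: le_trans (nm_Re _) (uM _).
  - exact: le_trans (nm_Im _) (uM _).
have [[a b] [_ cl]] := cK (v @ \oo) _ vI.
exists (a +i* b)%C => e e0 N.
have e2 : 0 < e / 2 by lra.
have hA : (v @ \oo) (v @` [set n | (N <= n)%N]) by exists N => // n Nn; exists n.
have hB : nbhs (a, b) (ball a (e / 2) `*` ball b (e / 2)).
  by exists (ball a (e / 2), ball b (e / 2)); [split; [exact: (nbhsx_ballx a _ e2)|exact: (nbhsx_ballx b _ e2)]|case].
have [p [[n Nn <-] [/= pa pb]]] := cl _ _ hA hB.
exists n => //; apply: le_lt_trans (nm_le_ReIm _) _.
move: pa pb; rewrite /v /ball /= ![`|_ - complex.Re _|]distrC ![`|_ - complex.Im _|]distrC.
by case: (u n) => x y /=; lra.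
Qed.

End modulus.

(** * Compactness, extreme values and uniform continuity *)

Section extreme_value.
Context {R : realType}.
Implicit Types (K : set (Cplx R)) (v : Cplx R -> R) (q : Cplx R -> Cplx R).

Definition rcont K v := forall z, K z -> forall e : R, 0 < e ->
  exists2 d : R, 0 < d & forall z', K z' -> nm (z' - z) < d -> `|v z' - v z| < e.

Definition ccont K q := forall z, K z -> forall e : R, 0 < e ->
  exists2 d : R, 0 < d & forall z', K z' -> nm (z' - z) < d -> nm (q z' - q z) < e.

(** Cluster points stand in for limits of subsequences, which avoids handling extractions. *)
Definition seq_compact K := forall u : nat -> Cplx R, (forall n, K (u n)) ->
  exists2 l, K l &
    forall e : R, 0 < e -> forall N, exists2 n, (N <= n)%N & nm (u n - l) < e.

Lemma bounded_closed_compact K (M : R) : (forall z, K z -> nm z <= M) ->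
  (forall z, (forall e : R, 0 < e -> exists2 y, K y & nm (y - z) < e) -> K z) ->
  seq_compact K.
Proof.
move=> KM Kc u Ku; have [l hl] := bolzano_weierstrass (fun n => KM _ (Ku n)).
exists l => //; apply: Kc => e e0.
by have [n _ h] := hl e e0 0%N; exists (u n).
Qed.

Lemma disc_compact (a : Cplx R) (r : R) : seq_compact [set z | nm (z - a) <= r].
Proof.
apply: (@bounded_closed_compact _ (nm a + r)) => z /= h.
  by have := nmD (z - a) a; rewrite subrK; lra.
rewrite leNgt; apply/negP => h1.
have [|y hy1 hy2] := h (nm (z - a) - r); first lra.
by have := nm_triangle y z a; rewrite (nmB z y); lra.
Qed.

Definition epsn (n : nat) : R := n.+1%:R^-1.

Lemma epsn_gt0 n : 0 < epsn n. Proof. by rewrite invr_gt0. Qed.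

Lemma epsn_small (e : R) : 0 < e -> exists N, forall n, (N <= n)%N -> epsn n < e.
Proof.
rewrite /epsn => e0; exists (Num.truncn e^-1) => n hn.
rewrite invf_plt ?posrE//; apply: lt_le_trans (truncnS_gt _) _.
by rewrite ler_nat ltnS.
Qed.

Lemma rcont_max K v : seq_compact K -> rcont K v -> K !=set0 ->
  exists2 z, K z & forall y, K y -> v y <= v z.
Proof.
move=> cK cv K0.
have bnd : exists B, forall z, K z -> v z <= B.
  apply: contrapT => /forallNP nb.
  have /choice[u hu] : forall n : nat, exists z, K z /\ n%:R < v z.
    move=> n; have /existsNP[z /not_implyP[Kz /negP]] := nb n%:R.
    by rewrite -ltNge => h; exists z.
  have [l Kl hl] := cK u (fun n => (hu n).1).
  have [d d0 hd] := cv l Kl 1 ltr01.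
  have [n hn /hd] := hl d d0 (Num.truncn (`|v l| + 1)).+1.
  move=> /(_ (hu n).1); rewrite ltr_norml => /andP[_ h].
  have := truncnS_gt (`|v l| + 1); have := (hu n).2.
  have := ler_norm (v l); have : (Num.truncn (`|v l| + 1)).+1%:R <= n%:R :> R.
    by rewrite ler_nat.
  by lra.
have [B hB] := bnd.
pose S := [set v z | z in K].
have hS : has_sup S.
  split; first by case: K0 => z Kz; exists (v z), z.
  by exists B => _ [z Kz <-]; exact: hB.
have /choice[u hu] : forall n : nat, exists z, K z /\ sup S - epsn n < v z.
  move=> n; have [_ [z Kz <-] h] := sup_adherent (epsn_gt0 n) hS.
  by exists z.
have [l Kl hl] := cK u (fun n => (hu n).1).
exists l => // y Ky; apply: (@le_trans _ _ (sup S)).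
  by apply: ub_le_sup; [case: hS | exists y].
rewrite leNgt; apply/negP => hlt.
pose e := (sup S - v l) / 2; have e0 : 0 < e by rewrite /e; lra.
have [d d0 hd] := cv l Kl e e0; have [N hN] := epsn_small e0.
have [n hn /hd] := hl d d0 N; move=> /(_ (hu n).1).
rewrite ltr_norml => /andP[_ h]; have := hN n hn; have := (hu n).2.
have : e + e = sup S - v l by rewrite /e; lra.
by move: h; move: (sup S) (v l) (v (u n)) (epsn n) => *; lra.
Qed.

Lemma rcont_min K v : seq_compact K -> rcont K v -> K !=set0 ->
  exists2 z, K z & forall y, K y -> v z <= v y.
Proof.
move=> cK cv K0; have cv' : rcont K (fun z => - v z).
  move=> z Kz e e0; have [d d0 hd] := cv z Kz e e0; exists d => // z' Kz' hz'.
  by rewrite -opprD normrN; exact: hd.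
have [z Kz h] := rcont_max cK cv' K0.
by exists z => // y /h; rewrite lerN2.
Qed.

Lemma ccont_nm K q : ccont K q -> rcont K (fun z => nm (q z)).
Proof.
move=> cq z Kz e e0; have [d d0 hd] := cq z Kz e e0; exists d => // z' Kz' /(hd _ Kz').
have := nmB_ge (q z') (q z); have := nmB_ge (q z) (q z').
by rewrite (nmB (q z)) ltr_norml => *; apply/andP; split; lra.
Qed.

Lemma ccont_uniform K q : seq_compact K -> ccont K q -> forall e : R, 0 < e ->
  exists2 d : R, 0 < d & forall z z', K z -> K z' -> nm (z' - z) < d -> nm (q z' - q z) < e.
Proof.
move=> cK cq e e0; apply: contrapT => nh.
have /choice[u hu] : forall n : nat, exists p : Cplx R * Cplx R,
    [/\ K p.1, K p.2, nm (p.2 - p.1) < epsn n & e <= nm (q p.2 - q p.1)].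
  move=> n; apply: contrapT => nh'; apply: nh; exists (epsn n).
    exact: epsn_gt0.
  move=> z z' Kz Kz' hz; rewrite ltNge; apply/negP => hq; apply: nh'.
  by exists (z, z').
have hu1 n : K (u n).1 by case: (hu n).
have [l Kl hl] := cK (fun n => (u n).1) hu1.
have e2 : 0 < e / 2 by lra.
have [d d0 hd] := cq l Kl _ e2.
have d2 : 0 < d / 2 by lra.
have [N hN] := epsn_small d2.
have [n /hN hn hln] := hl _ d2 N; case: (hu n) => k1 k2 h3 h4.
have := hd _ k1; have := hd _ k2.
have := nm_triangle (u n).1 (u n).2 l; have := nm_triangle (q l) (q (u n).2) (q (u n).1).
rewrite (nmB (q l) (q (u n).1)) => h5 h6 h7 h8.
have h9 := h7 _; have h10 := h8 _.
have {}h9 : nm (q (u n).2 - q l) < e / 2 by apply: h9; lra.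
have {}h10 : nm (q (u n).1 - q l) < e / 2 by apply: h10; lra.
lra.
Qed.

End extreme_value.

(** * The maximum modulus principle *)

Section max_principle.
Context {R : realType}.
Implicit Types (h q : Cplx R -> Cplx R) (z w a : Cplx R) (e t : R).

Definition disc : set (Cplx R) := [set z | nm z <= 1].

Lemma disc1_compact : seq_compact disc.
Proof.
have := @disc_compact R 0 1; rewrite /disc; congr (seq_compact _).
by apply/seteqP; split => z /=; rewrite subr0.
Qed.

(** Parseval's identity over the fourth roots of unity: the cross terms carry exponents that differ
    by 1 or 2, and the corresponding sums of powers of [i] vanish. *)
Lemma four_points_sqr (a0 a1 a2 : Cplx R) t (i := (0 +i* 1)%C : Cplx R)
    (p := fun w => a0 + a1 * w + a2 * w ^+ 2) :
  nm (p (rc t)) ^+ 2 + nm (p (- rc t)) ^+ 2 + nm (p (i * rc t)) ^+ 2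
    + nm (p (- (i * rc t))) ^+ 2
  = 4 * (nm a0 ^+ 2 + nm a1 ^+ 2 * t ^+ 2 + nm a2 ^+ 2 * t ^+ 4).
Proof.
rewrite {}/p {}/i /rc; case: a0 a1 a2 => [x0 y0] [x1 y1] [x2 y2].
rewrite !nm_sqr !expr2 /=; ring.
Qed.


Lemma small2 (a b : R) : 0 < a -> 0 < b -> exists t : R, [/\ 0 < t, t <= a & t <= b].
Proof. by move=> a0 b0; case: (lerP a b) => h; [exists a | exists b]; split=> //; lra. Qed.

Lemma small3 (a b c : R) : 0 < a -> 0 < b -> 0 < c ->
  exists t : R, [/\ 0 < t, t <= a, t <= b & t <= c].
Proof.
move=> a0 b0 c0; have [t [t0 ta tb]] := small2 a0 b0.
by have [u [u0 ut uc]] := small2 t0 c0; exists u; split=> //; lra.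
Qed.

Lemma rcontD K (u v : Cplx R -> R) : rcont K u -> rcont K v ->
  rcont K (fun z => u z + v z).
Proof.
move=> cu cv z Kz e e0; have e2 : 0 < e / 2 by lra.
have [d1 d10 h1] := cu z Kz _ e2; have [d2 d20 h2] := cv z Kz _ e2.
have [d [d0 dd1 dd2]] := small2 d10 d20; exists d => // y Ky yz.
rewrite opprD addrACA; apply: le_lt_trans (ler_normD _ _) _.
have := h1 y Ky (lt_le_trans yz dd1); have := h2 y Ky (lt_le_trans yz dd2); lra.
Qed.

Lemma rcontM K (u v : Cplx R -> R) : rcont K u -> rcont K v ->
  rcont K (fun z => u z * v z).
Proof.
move=> cu cv z Kz e e0.
pose b := 1 + `|u z| + `|v z|.
have b0 : 0 < b by have := normr_ge0 (u z); have := normr_ge0 (v z); rewrite /b; lra.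
have [e1 [e10 e1a e1b]] := small2 (divr_gt0 e0 b0) ltr01.
have [d1 d10 h1] := cu z Kz _ e10; have [d2 d20 h2] := cv z Kz _ e10.
have [d [d0 dd1 dd2]] := small2 d10 d20; exists d => // y Ky yz.
have {}h1 := h1 y Ky (lt_le_trans yz dd1); have {}h2 := h2 y Ky (lt_le_trans yz dd2).
have -> : u y * v y - u z * v z = (u y - u z) * (v y - v z) + (u y - u z) * v z
  + u z * (v y - v z) by ring.
apply: le_lt_trans (ler_normD _ _) _.
have := ler_normD ((u y - u z) * (v y - v z)) ((u y - u z) * v z); rewrite !normrM.
have eb : e1 * b <= e by rewrite -ler_pdivlMr.
have : e1 * b = e1 + e1 * `|u z| + e1 * `|v z| by rewrite /b; ring.
have := normr_ge0 (u z); have := normr_ge0 (v z); have := normr_ge0 (u y - u z).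
have := normr_ge0 (v y - v z).
move: `|u y - u z| `|v y - v z| `|u z| `|v z| h1 h2 => A B U V hA hB B0 A0 V0 U0 E1.
have : A * B < e1 by nra.
have : A * V <= e1 * V by apply: ler_wpM2r => //; lra.
have : U * B <= e1 * U by rewrite mulrC; apply: ler_wpM2r => //; lra.
by lra.
Qed.

Lemma rcont_cst K (c : R) : rcont K (fun=> c).
Proof. by move=> z Kz e e0; exists 1 => // y _ _; rewrite subrr normr0. Qed.

Lemma ccont_id (K : set (Cplx R)) : ccont K id.
Proof. by move=> z Kz e e0; exists e. Qed.

Definition expands2 q z a1 a2 := forall e : R, 0 < e ->
  exists2 d : R, 0 < d & forall w, nm w < d -> disc (z + w) ->
    nm (q (z + w) - (q z + a1 * w + a2 * w ^+ 2)) <= e * nm w ^+ 2.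

Lemma nm_sqr_ge (x p : Cplx R) : nm p ^+ 2 - 2 * nm p * nm (x - p) <= nm x ^+ 2.
Proof.
have := nmB_ge p (p - x); rewrite subKr (nmB p x) .
move: (nm p) (nm x) (nm (x - p)) (nm_ge0 p) (nm_ge0 x) (nm_ge0 (x - p)) => a b c *.
by have [ca|ca] := lerP c a; nra.
Qed.

(* The sum of [|h|^2] over the four points [z + i^k t] exceeds
   [4 |h z|^2] up to [o(t^2)], so [|h|^2 + e |z|^2] has no interior maximum. *)
Lemma max_principle h (B : R) : ccont disc h ->
  (forall z, nm z < 1 -> exists a1 a2, expands2 h z a1 a2) ->
  (forall z, nm z = 1 -> nm (h z) <= B) ->
  forall z, nm z <= 1 -> nm (h z) <= B.
Proof.
move=> hc hT hB z z1.
have B0 : 0 <= B by have := hB 1 nm1; have := nm_ge0 (h 1); lra.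
rewrite -(@ler_pXn2r _ 2%N) ?nnegrE ?nm_ge0//.
apply/ler_addgt0Pr => /= e; move=> e0.
pose v y := nm (h y) ^+ 2 + e * nm y ^+ 2.
have vc : rcont disc v.
  apply: rcontD; first by apply: rcontM; exact: ccont_nm.
  apply: rcontM; first exact: rcont_cst.
  by apply: rcontM; apply: ccont_nm; exact: ccont_id.
have [z0 z0D vmax] := rcont_max disc1_compact vc (ex_intro _ z z1).
have [z01|z01] := eqVneq (nm z0) 1.
  have := vmax _ z1; rewrite /v z01 expr1n mulr1.
  have := hB _ z01; have := nm_ge0 (h z0) ; have := nm_ge0 z.
  by move: (nm z) (nm (h z)) (nm (h z0)) => *; nra.
exfalso; have {}z01 : nm z0 < 1 by rewrite lt_neqAle z01.
have [a1 [a2 T]] := hT _ z01.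
pose P := nm (h z0) + nm a1 + nm a2.
have P0 : 0 <= P by rewrite /P; have := nm_ge0 (h z0); have := nm_ge0 a1; have := nm_ge0 a2; lra.
have e10 : 0 < e / (4 * (P + 1)) by apply: divr_gt0 => //; lra.
have [d d0 hd] := T _ e10.
have [t [t0 td t1 tz]] : exists t : R, [/\ 0 < t, t < d, t <= 1 & nm z0 + t <= 1].
  have [|||t [*]] := @small3 (d / 2) 1 (1 - nm z0); [lra..|].
  by exists t; split; lra.
pose p w := h z0 + a1 * w + a2 * w ^+ 2.
(* Summed over the four points, the allowed error costs [2 * e * t ^+ 2], whereas the term
   [e * nm y ^+ 2] of [v] gains [4 * e * t ^+ 2]; the difference contradicts the maximality of [v]
   at [z0]. *)
have pt w : nm w = t -> nm (p w) ^+ 2 - e / 2 * t ^+ 2 <= nm (h (z0 + w)) ^+ 2 /\ disc (z0 + w).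
  move=> wt; have zw : disc (z0 + w) by apply: le_trans (nmD _ _) _; rewrite wt.
  split=> //; apply: le_trans (nm_sqr_ge _ (p w)).
  have : nm w < d by rewrite wt.
  move=> /hd /(_ zw); rewrite -/(p w) wt.
  have : nm (p w) <= P.
    apply: le_trans (nmD _ _) _; rewrite /P.
    have := nmD (h z0) (a1 * w); rewrite [nm (a2 * _)]nmM [nm (a1 * _)]nmM nmX wt.
    have : nm a1 * t <= nm a1 by rewrite ler_piMr// nm_ge0.
    have : nm a2 * t ^+ 2 <= nm a2 by rewrite ler_piMr// ?nm_ge0// exprn_ile1// ltW.
    lra.
  have := nm_ge0 (p w).
  have : e / (4 * (P + 1)) * (4 * (P + 1)) = e by rewrite divfK//; lra.
  move: (e / (4 * (P + 1))) e10 (nm (p w)) (nm (_ - _)) (nm_ge0 (h (z0 + w) - p w)) => e1 e10 n1 n2 h0 h1 h2 h3 h4.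
  have : n1 * n2 <= P * (e1 * t ^+ 2).
    exact: ler_pM.
  have : P * (e1 * t ^+ 2) <= (P + 1) * (e1 * t ^+ 2).
    by apply: ler_wpM2r; [apply: mulr_ge0; [lra|exact: sqr_ge0]|lra].
  have : (P + 1) * (e1 * t ^+ 2) = e / 4 * t ^+ 2 by rewrite -h1; field.
  lra.
have nmi : nm ('i%C : Cplx R) = 1 by rewrite /nm /= expr0n /= add0r expr1n sqrtr1.
have nt : nm (rc t) = t by rewrite nm_rc ger0_norm// ltW.
have nit : nm ('i%C * rc t) = t by rewrite nmM nmi nt mul1r.
have [v1 /vmax w1] := pt _ nt.
have [v2 /vmax w2] := pt (- rc t) (etrans (nmN _) nt).
have [v3 /vmax w3] := pt _ nit.
have [v4 /vmax w4] := pt (- ('i%C * rc t)) (etrans (nmN _) nit).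
have /= F := four_points_sqr (h z0) a1 a2 t.
(* The same identity for the polynomial [z0 + w] evaluates the second term of [v] at the four
   points. *)
have G := four_points_sqr z0 1 0 t; cbv beta zeta in G.
rewrite !mul0r !mul1r !addr0 nm1 nm0 expr1n mul1r [in RHS]expr0n /= mul0r addr0 in G.
rewrite -![h z0 + _ + _]/(p _) in F.
rewrite /v in w1 w2 w3 w4.
have := mulr_ge0 (sqr_ge0 (nm a1)) (sqr_ge0 t).
have := mulr_ge0 (sqr_ge0 (nm a2)) (exprn_ge0 4 (ltW t0)).
have t2 : 0 < t ^+ 2 by rewrite exprn_gt0.
have := mulr_gt0 e0 t2.
have := congr1 (fun x => e * x) G.
lra.
Qed.

End max_principle.

(** * Analytic discs and Schwarz's lemma *)

Section discs.
Context {R : realType}.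
Implicit Types (h q s : Cplx R -> Cplx R) (z w a : Cplx R) (e t : R).

Lemma disc0 : disc (0 : Cplx R).
Proof. by have h : nm (0 : Cplx R) <= 1 by rewrite nm0. Qed.

Definition expands3 q z a1 a2 a3 := forall e : R, 0 < e ->
  exists2 d : R, 0 < d & forall w, nm w < d -> disc (z + w) ->
    nm (q (z + w) - (q z + a1 * w + a2 * w ^+ 2 + a3 * w ^+ 3)) <= e * nm w ^+ 3.

(* Stands in for holomorphy on the closed unit disc. The maximum principle needs
   expansions of order 2, and dividing by [z] in Schwarz's lemma loses one order. *)
Definition analytic_disc q := forall z, disc z -> exists a1 a2 a3, expands3 q z a1 a2 a3.

Definition slope0 q a := exists a2 a3, expands3 q 0 a a2 a3.

Lemma expands2_linear q z a1 a2 : expands2 q z a1 a2 ->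
  exists2 L : R, 0 < L & exists2 d : R, 0 < d & forall w, nm w < d -> disc (z + w) ->
    nm (q (z + w) - q z) <= L * nm w.
Proof.
move=> /(_ 1 ltr01)[d d0 hd].
pose L := nm a1 + nm a2 + 1.
have L0 : 0 < L by rewrite /L; have := nm_ge0 a1; have := nm_ge0 a2; lra.
exists L => //; have [t [t0 td t1]] := small2 d0 ltr01; exists t => // w wt zw.
have := hd w (lt_le_trans wt td) zw.
set x := q (z + w) - q z; set y := _ - _.
have -> : x = y + (a1 * w + a2 * w ^+ 2) by rewrite /x /y; ring.
move=> hy; apply: le_trans (nmD _ _) _.
have h2 := nmD (a1 * w) (a2 * w ^+ 2).
rewrite [nm (a1 * w)]nmM [nm (a2 * _)]nmM !nmX in h2.
have w0 := nm_ge0 w; have w1 : nm w <= 1 by lra.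
have e2 : nm w ^+ 2 <= nm w by rewrite expr2; nra.
have := ler_wpM2l (nm_ge0 a2) e2.
rewrite /L !mulrDl; lra.
Qed.

Lemma expands3_expands2 q z a1 a2 a3 : expands3 q z a1 a2 a3 -> expands2 q z a1 a2.
Proof.
move=> T e e0; have [d d0 hd] := T 1 ltr01.
have a30 := nm_ge0 a3.
have k0 : 0 < 1 + nm a3 by lra.
have [t [t0 td te]] := small2 d0 (divr_gt0 e0 k0); exists t => // w wt zw.
have := hd w (lt_le_trans wt td) zw.
set y := _ - _ => hy; set x := _ - _.
have -> : x = y + a3 * w ^+ 3 by rewrite /x /y; ring.
apply: le_trans (nmD _ _) _; rewrite nmM nmX.
have : (1 + nm a3) * nm w <= e by rewrite mulrC -ler_pdivlMr//; lra.
have := sqr_ge0 (nm w) => h1 /(ler_wpM2r h1).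
rewrite [nm w ^+ 3]exprSr in hy *; rewrite mulrDl mulrDl; lra.
Qed.

Lemma expands2_continuous q z a1 a2 : expands2 q z a1 a2 ->
  forall e : R, 0 < e -> exists2 d : R, 0 < d &
    forall z', disc z' -> nm (z' - z) < d -> nm (q z' - q z) < e.
Proof.
move=> /expands2_linear[L L0 [d d0 hd]] e e0.
have [t [t0 td te]] := small2 d0 (divr_gt0 e0 L0); exists t => // z' z'D zz'.
have := hd (z' - z); rewrite [z + _]addrC subrK => /(_ (lt_le_trans zz' td) z'D) h.
apply: le_lt_trans h _; rewrite mulrC -ltr_pdivlMr//; lra.
Qed.

Lemma analytic_ccont q : analytic_disc q -> ccont disc q.
Proof.
move=> hq z zD e e0; have [a1 [a2 [a3 /expands3_expands2 T]]] := hq z zD.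
exact: expands2_continuous T e e0.
Qed.
(* Schwarz's lemma, for the quotient [(q - q 0) / z]. *)
Lemma slope0_bound q a (B : R) : analytic_disc q -> slope0 q a ->
  (forall z, disc z -> nm (q z) <= B) -> nm a <= 2 * B.
Proof.
move=> hq [a2 [a3 T0]] qB.
pose h z := if z == 0 then a else (q z - q 0) / z.
have hz z : z * h z = q z - q 0.
  rewrite /h; case: eqVneq => [->|z0]; first by rewrite mul0r subrr.
  by rewrite mulrC divfK.
have -> : a = h 0 by rewrite /h eqxx.
have ex z : disc z -> exists b1 b2, expands2 h z b1 b2.
  move=> zD; have [zz0|z0] := eqVneq z 0.
    exists a2, a3 => e e0; have [d d0 hd] := T0 e e0; exists d => // w wd wD.
    rewrite zz0 in wD *; have := hd w wd wD; rewrite add0r.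
    have [->|w0] := eqVneq w 0.
      have -> : h 0 - (h 0 + a2 * 0 + a3 * 0 ^+ 2) = 0 by ring.
      by move=> _; rewrite !nm0 expr0n /= mulr0.
    have -> : q w - (q 0 + a * w + a2 * w ^+ 2 + a3 * w ^+ 3)
        = (h w - (h 0 + a2 * w + a3 * w ^+ 2)) * w.
      by rewrite mulrBl [h w * w]mulrC hz /h eqxx; ring.
    by rewrite nmM [nm w ^+ 3]exprSr mulrA ler_pM2r ?nm_gt0.
  have [b1 [b2 [b3 T]]] := hq z zD.
  (* Division of power series: the coefficients make [(z + w) * (h z + h1 * w + h2 * w ^+ 2)] agree
     with the expansion of [q (z + w) - q 0] up to the leftover [h2 * w ^+ 3]. *)
  pose h1 := (b1 - h z) / z; pose h2 := (b2 - h1) / z.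
  exists h1, h2 => e e0.
  have z0' : 0 < nm z / 2 by have := z0; rewrite -nm_gt0; lra.
  have E2 : 0 < e * (nm z / 2) / 2 by apply: divr_gt0 => //; exact: mulr_gt0.
  have [d d0 hd] := expands3_expands2 T E2.
  pose k := nm h2 + 1; have k0 : 0 < k by rewrite /k; have := nm_ge0 h2; lra.
  have [t [t0 td tz tk]] := small3 d0 z0' (divr_gt0 E2 k0).
  exists t => // w wt zw; have := hd w (lt_le_trans wt td) zw.
  set y := _ - _ => hy; set x := _ - _.
  have xE : (z + w) * x = y - h2 * w ^+ 3.
    rewrite /x mulrBr hz /y.
    have e1 : h1 * z = b1 - h z by rewrite divfK.
    have e3 : h2 * z = b2 - h1 by rewrite divfK.
    have e4 := hz z; rewrite -[q z](subrK (q 0)) -e4.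
    have -> : b2 = h2 * z + h1 by rewrite e3 subrK.
    have -> : b1 = h1 * z + h z by rewrite e1 subrK.
    ring.
  have zw0 : nm z / 2 <= nm (z + w) by have := nmB_ge z (- w); rewrite opprK nmN; lra.
  have : nm (z + w) * nm x <= e * (nm z / 2) * nm w ^+ 2.
    rewrite -nmM xE; apply: le_trans (nmD _ _) _; rewrite nmN nmM nmX.
    have : k * nm w <= e * (nm z / 2) / 2 by rewrite mulrC -ler_pdivlMr//; lra.
    have w2 := sqr_ge0 (nm w) => /(ler_wpM2r w2).
    have := nm_ge0 w; have : nm h2 <= k by rewrite /k; lra.
    rewrite [nm w ^+ 3]exprSr.
    move: hy; move: (nm w ^+ 2) w2 => W W0 hy h3 h4.
    have := ler_wpM2r (mulr_ge0 W0 h4) h3; lra.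
  have := ler_wpM2r (nm_ge0 x) zw0 => h3 h4.
  rewrite -(@ler_pM2l _ (nm z / 2))//; lra.
apply: (@max_principle _ h (2 * B)) => //.
- by move=> z zD; have [b1 [b2 E]] := ex z zD; exact: expands2_continuous E.
- by move=> z z1; apply: ex; rewrite /disc /= ltW.
- move=> z z1; have := congr1 (@nm R) (hz z); rewrite nmM z1 mul1r => ->.
  have := nmD (q z) (- q 0); rewrite nmN.
  have zD : disc z by rewrite /disc /= z1.
  by have := qB _ zD; have := qB _ disc0; lra.
- exact: disc0.
Qed.

End discs.

(** * Continuous square roots on the disc *)

Section square_roots.
Context {R : realType}.
Implicit Types (q s u v : Cplx R -> Cplx R) (z w : Cplx R) (e t : R).

Lemma ccontM K u v : ccont K u -> ccont K v -> ccont K (fun z => u z * v z).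
Proof.
move=> cu cv z Kz e e0.
pose b := 1 + nm (u z) + nm (v z).
have b0 : 0 < b by have := nm_ge0 (u z); have := nm_ge0 (v z); rewrite /b; lra.
have [e1 [e10 e1a e1b]] := small2 (divr_gt0 e0 b0) ltr01.
have [d1 d10 h1] := cu z Kz _ e10; have [d2 d20 h2] := cv z Kz _ e10.
have [d [d0 dd1 dd2]] := small2 d10 d20; exists d => // y Ky yz.
have {}h1 := h1 y Ky (lt_le_trans yz dd1); have {}h2 := h2 y Ky (lt_le_trans yz dd2).
have -> : u y * v y - u z * v z = (u y - u z) * (v y - v z) + (u y - u z) * v z
  + u z * (v y - v z) by ring.
apply: le_lt_trans (nmD _ _) _.
have := nmD ((u y - u z) * (v y - v z)) ((u y - u z) * v z); rewrite !nmM.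
have eb : e1 * b <= e by rewrite -ler_pdivlMr.
have : e1 * b = e1 + e1 * nm (u z) + e1 * nm (v z) by rewrite /b; ring.
have := nm_ge0 (u z); have := nm_ge0 (v z); have := nm_ge0 (u y - u z).
have := nm_ge0 (v y - v z).
move: (nm (u y - u z)) (nm (v y - v z)) (nm (u z)) (nm (v z)) h1 h2 => A B U V hA hB B0 A0 V0 U0 E1.
have : A * B < e1 by nra.
have : A * V <= e1 * V by apply: ler_wpM2r => //; lra.
have : U * B <= e1 * U by rewrite mulrC; apply: ler_wpM2r => //; lra.
by lra.
Qed.

Lemma ccontV K u : ccont K u -> (forall z, K z -> u z != 0) ->
  ccont K (fun z => (u z)^-1).
Proof.
move=> cu u0 z Kz e e0.
have a0 : 0 < nm (u z) by rewrite nm_gt0 u0.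
have [e1 [e10 e1a e1b]] := small2 (divr_gt0 a0 (ltr0Sn R 1)) (divr_gt0 (mulr_gt0 e0 (exprn_gt0 2 a0)) (ltr0Sn R 1)).
have [d d0 h] := cu z Kz _ e10; exists d => // y Ky yz.
have {}h := h y Ky yz.
have b0 : 0 < nm (u y) by rewrite nm_gt0 u0.
have hb : nm (u z) / 2 <= nm (u y).
  by have := nmB_ge (u z) (u y); rewrite nmB; lra.
have -> : (u y)^-1 - (u z)^-1 = - (u y - u z) / (u y * u z).
  by field; rewrite !u0.
rewrite nmM nmN nmV nmM ltr_pdivrMr ?mulr_gt0//.
apply: lt_le_trans h _; apply: le_trans e1b _.
rewrite expr2; move: (nm (u z)) (nm (u y)) a0 hb => a b a0 hb.
have := ler_wpM2l (ltW (mulr_gt0 e0 a0)) hb; lra.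
Qed.

(** On the disc of radius 1 about 1 this branch has positive real part, so two of its values cannot
    nearly cancel; its continuity there follows by factoring a difference of squares. *)
Definition psqrt z : Cplx R :=
  let s := sqrtc (z : complex R) in if 0 <= complex.Re s then s else - s.

Lemma psqrt_sqr z : psqrt z ^+ 2 = z.
Proof. by rewrite /psqrt; case: ifP => _; rewrite ?sqrrN; exact: sqr_sqrtc. Qed.

Lemma ReD z w : complex.Re (z + w) = complex.Re z + complex.Re w.
Proof. by case: z w => [a b] [c d]. Qed.

Lemma psqrt_Re z : nm (z - 1) < 1 -> 0 < complex.Re (psqrt z).
Proof.
move=> z1; rewrite lt_neqAle; apply/andP; split; last first.
  rewrite /psqrt; case: ifP => // /negbT; rewrite -ltNge.
  by case: (sqrtc _) => a b /=; lra.
apply/negP => /eqP h; have := psqrt_sqr z; case: (psqrt z) h => a b /= <- hz.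
have hr : complex.Re (z - 1) <= -1.
  by rewrite -hz expr2 /=; have := sqr_ge0 b; rewrite expr2; lra.
by have := nm_Re (z - 1); have := ler_norm (- complex.Re (z - 1)); rewrite normrN; lra.
Qed.

Lemma psqrt_lip z w : nm (z - 1) < 1 -> nm (w - 1) < 1 ->
  complex.Re (psqrt z) * nm (psqrt w - psqrt z) <= nm (w - z).
Proof.
move=> /psqrt_Re z1 /psqrt_Re w1; rewrite -{2}(psqrt_sqr w) -{3}(psqrt_sqr z).
rewrite subr_sqr nmM mulrC; apply: ler_wpM2l; first exact: nm_ge0.
have := nm_Re (psqrt w + psqrt z); rewrite ReD => h.
by have := ler_norm (complex.Re (psqrt w) + complex.Re (psqrt z)); lra.
Qed.

Lemma ccont_psqrt K u : ccont K u -> (forall z, K z -> nm (u z - 1) < 1) ->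
  ccont K (fun z => psqrt (u z)).
Proof.
move=> cu u1 z Kz e e0; have r0 := psqrt_Re (u1 z Kz).
have [d d0 h] := cu z Kz _ (mulr_gt0 r0 e0); exists d => // y Ky /(h y Ky) yz.
have := psqrt_lip (u1 _ Kz) (u1 _ Ky) => /le_lt_trans /(_ yz).
by rewrite ltr_pM2l.
Qed.

Lemma psqrt1 : psqrt 1 = 1.
Proof.
have h : 0 < complex.Re (psqrt 1) by apply: psqrt_Re; rewrite subrr nm0.
have := psqrt_sqr 1 => /eqP; rewrite sqrf_eq1 => /orP[/eqP//|/eqP h1].
by exfalso; move: h; rewrite h1 /=; lra.
Qed.

Lemma disc_scale z t : disc z -> 0 <= t -> t <= 1 -> disc (rc t * z).
Proof.
rewrite /disc /= nmM nm_rc => z1 t0 t1; rewrite ger0_norm//.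
have := nm_ge0 z; nra.
Qed.

Lemma ccont_scale q t : ccont disc q -> 0 <= t -> t <= 1 ->
  ccont disc (fun z => q (rc t * z)).
Proof.
move=> cq t0 t1 z zD e e0; have [d d0 h] := cq _ (disc_scale zD t0 t1) e e0.
exists d => // y yD yz; apply: h; first exact: disc_scale.
rewrite -mulrBr nmM nm_rc ger0_norm//; apply: le_lt_trans yz.
by rewrite ler_piMl// nm_ge0.
Qed.

(* Multiply the principal square roots of the ratios
   [q ((k + 1) z / N) / q (k z / N)], which are uniformly close to 1. *)
Lemma disc_sqrt q (a : Cplx R) : ccont disc q -> (forall z, disc z -> q z != 0) ->
  a ^+ 2 = q 0 ->
  exists s, [/\ ccont disc s, s 0 = a & forall z, disc z -> s z ^+ 2 = q z].
Proof.
move=> cq q0 aq.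
have [m mD mmin] := rcont_min (@disc1_compact R) (ccont_nm cq) (ex_intro _ _ (@disc0 R)).
have m0 : 0 < nm (q m) by rewrite nm_gt0 q0.
have [d d0 hd] := ccont_uniform (@disc1_compact R) cq m0.
have [N /(_ _ (leqnn N)) hN] := epsn_small d0.
have key k : (k <= N.+1)%N -> exists s, [/\ ccont disc s, s 0 = a &
    forall z, disc z -> s z ^+ 2 = q (rc (k%:R * epsn N) * z)].
  elim: k => [_|k IH kN].
    exists (fun=> a); split=> //; last by move=> z _; rewrite mul0r rc0 mul0r.
    by move=> z Kz e e0; exists 1 => // y _ _; rewrite subrr nm0.
  have [s [sc s0 sq]] := IH (ltnW kN).
  pose t : R := k%:R * epsn N; pose t' : R := k.+1%:R * epsn N.
  have NE : N.+1%:R * epsn N = 1 :> R by rewrite /epsn divff.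
  have t't : t' = t + epsn N by rewrite /t' /t -natr1 mulrDl mul1r.
  have e0 := @epsn_gt0 R N.
  have t0 : 0 <= t by rewrite mulr_ge0// ltW.
  have t'1 : t' <= 1 by rewrite -NE ler_wpM2r ?ler_nat// ltW.
  have t'0 : 0 <= t' by lra.
  have t1 : t <= 1 by lra.
  pose r z := q (rc t' * z) / q (rc t * z).
  have q1 z : disc z -> q (rc t * z) != 0 by move=> zD; apply/q0/disc_scale.
  have r1 z : disc z -> nm (r z - 1) < 1.
    move=> zD; have -> : r z - 1 = (q (rc t' * z) - q (rc t * z)) / q (rc t * z).
      by rewrite /r mulrBl divff// q1.
    rewrite nmM nmV ltr_pdivrMr ?nm_gt0 ?q1// mul1r.
    apply: (@lt_le_trans _ _ (nm (q m))); last exact/mmin/disc_scale.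
    apply: hd; [exact: disc_scale..|].
    rewrite -mulrBl t't rcD addrC addKr nmM nm_rc ger0_norm ?(ltW e0)//.
    by apply: le_lt_trans hN; rewrite ler_piMr// ltW.
  have rc' : ccont disc r.
    by apply: ccontM; [|apply: ccontV => //]; exact: ccont_scale.
  exists (fun z => s z * psqrt (r z)); split.
  - by apply: ccontM => //; exact: ccont_psqrt.
  - by rewrite s0 /r !mulr0 divff ?psqrt1 ?mulr1// q0//; exact: disc0.
  - by move=> z zD; rewrite exprMn sq// psqrt_sqr /r mulrC divfK// q1.
have [s [sc s0 sq]] := key _ (leqnn _); exists s; split=> // z zD.
by rewrite sq// /epsn divff// mul1r.
Qed.

End square_roots.

(** * Lifting analytic discs through a quadratic map *)

Section lifting.
Context {R : realType}.
Implicit Types (p q s u v phi psi : Cplx R -> Cplx R) (a b c z w : Cplx R) (e t : R).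

Lemma expands3_ext q u z a1 a2 a3 : (forall z, disc z -> q z = u z) -> disc z ->
  expands3 q z a1 a2 a3 -> expands3 u z a1 a2 a3.
Proof.
move=> qu zD T e e0; have [d d0 hd] := T e e0; exists d => // w wd zw.
by rewrite -!qu//; exact: hd.
Qed.

Lemma expands3_addlin q z a1 a2 a3 a b : expands3 q z a1 a2 a3 ->
  expands3 (fun z => q z + (a + b * z)) z (a1 + b) a2 a3.
Proof.
move=> T e e0; have [d d0 hd] := T e e0; exists d => // w wd zw.
set x := _ - _.
have -> : x = q (z + w) - (q z + a1 * w + a2 * w ^+ 2 + a3 * w ^+ 3) by rewrite /x; ring.
exact: hd.
Qed.

Lemma expands3_cst a z : expands3 (fun=> a) z 0 0 0.
Proof.
move=> e e0; exists 1 => // w _ _; set x := _ - _.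
have -> : x = 0 by rewrite /x; ring.
by rewrite nm0 mulr_ge0 ?exprn_ge0 ?nm_ge0// ltW.
Qed.

Lemma analytic_addlin q a b : analytic_disc q ->
  analytic_disc (fun z => q z + (a + b * z)).
Proof.
move=> hq z zD; have [a1 [a2 [a3 T]]] := hq z zD.
by exists (a1 + b), a2, a3; exact: expands3_addlin.
Qed.

Lemma slope0_addlin q x a b : slope0 q x -> slope0 (fun z => q z + (a + b * z)) (x + b).
Proof. by move=> [a2 [a3 T]]; exists a2, a3; exact: expands3_addlin. Qed.

Lemma analytic_affine a b : analytic_disc (fun z => a + b * z).
Proof.
move=> z zD; exists (0 + b), 0, 0; apply: (expands3_ext _ zD (expands3_addlin a b (expands3_cst 0 z))).
by move=> y yD; rewrite add0r.
Qed.

Lemma slope0_affine a b : slope0 (fun z => a + b * z) b.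
Proof.
exists 0, 0; have -> : expands3 (fun z => a + b * z) 0 b = expands3 (fun z => a + b * z) 0 (0 + b) by rewrite add0r.
apply: (expands3_ext _ (@disc0 R) (expands3_addlin a b (expands3_cst 0 0))).
by move=> y yD; rewrite !add0r.
Qed.

Lemma disc_mul a z : disc a -> disc z -> disc (a * z).
Proof.
rewrite /disc /= nmM => a1 z1; have := nm_ge0 a; have := nm_ge0 z; nra.
Qed.

Lemma analytic_scale q a : disc a -> analytic_disc q -> analytic_disc (fun z => q (a * z)).
Proof.
move=> aD hq z zD; have [a1 [a2 [a3 T]]] := hq _ (disc_mul aD zD).
exists (a1 * a), (a2 * a ^+ 2), (a3 * a ^+ 3) => e e0.
have [d d0 hd] := T e e0; exists d => // w wd zw.
have aw : nm (a * w) <= nm w.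
  by rewrite nmM; have := nm_ge0 w; move: aD; rewrite /disc /=; have := nm_ge0 a; nra.
have := hd (a * w) (le_lt_trans aw wd); rewrite -mulrDr => /(_ (disc_mul aD zw)) h.
have -> : q (a * z) + a1 * a * w + a2 * a ^+ 2 * w ^+ 2 + a3 * a ^+ 3 * w ^+ 3
  = q (a * z) + a1 * (a * w) + a2 * (a * w) ^+ 2 + a3 * (a * w) ^+ 3 by ring.
apply: le_trans h _; apply: ler_wpM2l; first exact: ltW.
by rewrite ler_pXn2r ?nnegrE ?nm_ge0.
Qed.

(** The coefficients solve [p ^+ 2 = q] up to order 3. Then [s - p] is [q - p ^+ 2] divided by
    [s + p], and continuity of [s] keeps [s + p] close to [2 * s z], away from 0. The constants
    [k4], [k5], [k6] are the coefficients of [p ^+ 2] in degrees 4 to 6. *)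
Lemma expands3_sqrt q s z a1 a2 a3 : disc z -> ccont disc s ->
  (forall y, disc y -> s y ^+ 2 = q y) -> s z != 0 -> expands3 q z a1 a2 a3 ->
  exists b2 b3 : Cplx R, expands3 s z (a1 / (2 * s z)) b2 b3.
Proof.
move=> zD cs sq sz T; set s0 := s z.
have two0 : (2 : Cplx R) != 0 by rewrite pnatr_eq0.
have ts0 : 2 * s0 != 0 by rewrite mulf_neq0.
pose s1 := a1 / (2 * s0); pose s2 := (a2 - s1 ^+ 2) / (2 * s0).
pose s3 := (a3 - 2 * s1 * s2) / (2 * s0).
exists s2, s3 => e e0; rewrite -/s1 -/s0.
have n0 : 0 < nm s0 by rewrite nm_gt0.
have e1 : s1 * (2 * s0) = a1 by rewrite divfK.
have e2 : s2 * (2 * s0) = a2 - s1 ^+ 2 by rewrite divfK.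
have e3 : s3 * (2 * s0) = a3 - 2 * s1 * s2 by rewrite divfK.
pose k4 := 2 * s1 * s3 + s2 ^+ 2; pose k5 := 2 * s2 * s3; pose k6 := s3 ^+ 2.
pose B := nm k4 + nm k5 + nm k6 + 1.
have B0 : 0 < B.
  by rewrite /B; have := nm_ge0 k4; have := nm_ge0 k5; have := nm_ge0 k6; lra.
pose D := nm s1 + nm s2 + nm s3 + 1.
have D0 : 0 < D.
  by rewrite /D; have := nm_ge0 s1; have := nm_ge0 s2; have := nm_ge0 s3; lra.
have E2 : 0 < e * nm s0 / 2 by apply: divr_gt0 => //; exact: mulr_gt0.
have n2 : 0 < nm s0 / 2 by lra.
have [d1 d10 hd1] := T _ E2.
have [d2 d20 hd2] := cs z zD _ n2.
have [t1 [t10 td1 td2]] := small2 d10 d20.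
have [t2 [t20 tB tD t21]] := small3 (divr_gt0 E2 B0) (divr_gt0 n2 D0) ltr01.
have [t [t0 tt1 tt2]] := small2 t10 t20; exists t => // w wt zw.
pose p := s0 + s1 * w + s2 * w ^+ 2 + s3 * w ^+ 3; rewrite -/p.
have w0 := nm_ge0 w; have w1 : nm w <= 1 by lra.
have ws2 : nm w ^+ 2 <= nm w by rewrite expr2; nra.
have ws3 : nm w ^+ 3 <= nm w by rewrite exprS; nra.
have hp : nm (p - s0) <= nm s0 / 2.
  have -> : p - s0 = s1 * w + s2 * w ^+ 2 + s3 * w ^+ 3 by rewrite /p; ring.
  apply: le_trans (nmD _ _) _.
  have h2 := nmD (s1 * w) (s2 * w ^+ 2).
  rewrite [nm (s1 * w)]nmM [nm (s2 * _)]nmM !nmX in h2.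
  rewrite [nm (s3 * _)]nmM !nmX.
  have := ler_wpM2l (nm_ge0 s2) ws2; have := ler_wpM2l (nm_ge0 s3) ws3.
  have : D * nm w <= nm s0 / 2 by rewrite mulrC -ler_pdivlMr//; lra.
  rewrite /D !mulrDl; lra.
have hs : nm (s (z + w) - s0) < nm s0 / 2.
  by apply: hd2 => //; rewrite addrAC subrr add0r; lra.
have hsp : nm s0 <= nm (s (z + w) + p).
  have := nmB_ge (2 * s0) (2 * s0 - (s (z + w) + p)); rewrite subKr.
  have -> : 2 * s0 - (s (z + w) + p) = - ((s (z + w) - s0) + (p - s0)) by ring.
  rewrite nmN nmM; have := nmD (s (z + w) - s0) (p - s0).
  have -> : nm (2 : Cplx R) = 2 by rewrite -rc_nat nm_rc ger0_norm.
  lra.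
have hq : nm (q (z + w) - p ^+ 2) <= e * nm s0 * nm w ^+ 3.
  have := hd1 w; set y := _ - _ => h.
  have -> : q (z + w) - p ^+ 2 = y - (k4 + k5 * w + k6 * w ^+ 2) * w ^+ 4.
    rewrite /y /p /k4 /k5 /k6 -(sq _ zD) -/s0 -e1.
    have -> : a2 = s2 * (2 * s0) + s1 ^+ 2 by rewrite e2 subrK.
    have -> : a3 = s3 * (2 * s0) + 2 * s1 * s2 by rewrite e3 subrK.
    ring.
  have {}h : nm y <= e * nm s0 / 2 * nm w ^+ 3 by apply: h => //; lra.
  apply: le_trans (nmD _ _) _; rewrite nmN nmM nmX.
  have hB : nm (k4 + k5 * w + k6 * w ^+ 2) <= B.
    apply: le_trans (nmD _ _) _; have := nmD k4 (k5 * w).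
    rewrite [nm (k5 * _)]nmM [nm (k6 * _)]nmM nmX.
    have : nm k5 * nm w <= nm k5 by rewrite ler_piMr ?nm_ge0.
    have : nm k6 * nm w ^+ 2 <= nm k6 by rewrite ler_piMr ?nm_ge0 ?exprn_ile1.
    rewrite /B; lra.
  have w3 : 0 <= nm w ^+ 3 by rewrite exprn_ge0.
  have : B * nm w <= e * nm s0 / 2 by rewrite mulrC -ler_pdivlMr//; lra.
  move=> /(ler_wpM2r w3).
  have := ler_wpM2r (mulr_ge0 w0 w3) hB; rewrite [nm w ^+ 4]exprS; lra.
have : nm (s (z + w) - p) * nm (s (z + w) + p) <= e * nm s0 * nm w ^+ 3.
  by rewrite -nmM -subr_sqr sq.
have := ler_wpM2l (nm_ge0 (s (z + w) - p)) hsp => h1 h2.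
rewrite -(@ler_pM2r _ (nm s0))//; lra.
Qed.

Definition is_lift c phi psi := forall z, disc z -> psi z ^+ 2 + c = phi z.

Lemma disc_lift c phi a : analytic_disc phi -> (forall z, disc z -> phi z != c) ->
  a ^+ 2 + c = phi 0 ->
  exists psi, [/\ analytic_disc psi, psi 0 = a, is_lift c phi psi &
    forall b, slope0 phi b -> slope0 psi (b / (2 * a))].
Proof.
move=> hphi phic ac; pose q z := phi z + (- c + 0 * z).
have hq : analytic_disc q by exact: analytic_addlin.
have qE z : q z = phi z - c by rewrite /q mul0r addr0.
have q0 z : disc z -> q z != 0 by move=> zD; rewrite qE subr_eq0 phic.
have [|s [cs s0 sq]] := disc_sqrt (analytic_ccont hq) q0 (a := a).
  by rewrite qE -ac addrK.
have sn0 z : disc z -> s z != 0.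
  by move=> zD; rewrite -sqrf_eq0 sq// q0.
exists s; split=> //.
- move=> z zD; have [a1 [a2 [a3 T]]] := hq z zD.
  have [s2 [s3 T']] := expands3_sqrt zD cs sq (sn0 z zD) T.
  by exists (a1 / (2 * s z)), s2, s3.
- by move=> z zD; rewrite sq// qE subrK.
- move=> b hb; have [a2 [a3 T]] := slope0_addlin (- c) 0 hb.
  have [s2 [s3 T']] := expands3_sqrt (@disc0 R) cs sq (sn0 0 (@disc0 R)) T.
  by exists s2, s3; rewrite -s0 -[b]addr0.
Qed.

End lifting.

(** * Inverse branches along an attracting cycle *)

Section inverse_branches.
Context {R : realType}.
Implicit Types (phi psi : Cplx R -> Cplx R) (c x y z w : Cplx R) (e t k : R).

Lemma geometric_small k e : 0 <= k -> k < 1 -> 0 < e -> exists n, k ^+ n < e.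
Proof.
move=> k0 k1 e0; have := @cvg_expr R k; rewrite ger0_norm// => /(_ k1) /cvgrPdist_lt /(_ e e0).
case=> N _ /(_ N (leqnn N)) /=; rewrite sub0r normrN ger0_norm ?exprn_ge0// => h.
by exists N.
Qed.

(* The difference quotient of the [p]-th iterate between [x] and [y]; on the
   diagonal it is the derivative of the iterate. *)
Definition multiplier c p x y : Cplx R :=
  \prod_(i < p) (iter i (quad c) x + iter i (quad c) y).

Lemma iter_quadB c p x y :
  iter p (quad c) x - iter p (quad c) y = (x - y) * multiplier c p x y.
Proof.
rewrite /multiplier; elim: p => [|p IH]; first by rewrite big_ord0 mulr1.
rewrite big_ord_recr /= mulrA -IH /quad; ring.
Qed.

Lemma iter_backward c (z : nat -> Cplx R) : (forall n, quad c (z n.+1) = z n) ->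
  forall m n, iter m (quad c) (z (n + m)%N) = z n.
Proof.
move=> hz; elim=> [|m IH] n; first by rewrite addn0.
by rewrite iterSr addnS hz.
Qed.

Lemma nm_quad_ge c z : 2 + nm c <= nm z -> nm z <= nm (quad c z).
Proof.
move=> h; rewrite /quad; have := nmB_ge (z ^+ 2) (- c); rewrite opprK nmN nmX.
have := nm_ge0 c; nra.
Qed.

Lemma nm_iter_quad_le c n z (B : R) : 2 + nm c <= B ->
  nm (iter n (quad c) z) <= B -> nm z <= B.
Proof.
move=> hB; elim: n => // n IH h; apply: IH.
by rewrite leNgt; apply/negP => h1; have := @nm_quad_ge c (iter n (quad c) z); rewrite /= in h; lra.
Qed.

(** This serves twice: it brings the critical orbit to the cycle, and it finds critical points in
    the pullbacks of a backward orbit that runs along an attracting cycle. *)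
Lemma backward_hits_critical_value c (z : nat -> Cplx R) p (al : Cplx R) (r : R) :
  (forall n, quad c (z n.+1) = z n) -> (forall n, z (p * n)%N = al) ->
  nm (multiplier c p al al) < 1 -> 0 < r ->
  exists n phi, [/\ analytic_disc phi, phi 0 = z n,
    forall y, disc y -> iter n (quad c) (phi y) = al + rc r * y &
    exists2 y, disc y & phi y = c].
Proof.
move=> hz hp hk r0; apply: contrapT => nohit.
have z0 : z 0%N = al by rewrite -(hp 0%N) muln0.
(* The last equation is the chain rule for the lifts, kept in product form. *)
have key n : exists phi b, [/\ analytic_disc phi, phi 0 = z n,
    forall y, disc y -> iter n (quad c) (phi y) = al + rc r * y, slope0 phi b &
    b * \prod_(0 <= i < n) (2 * z i.+1) = rc r].
  elim: n => [|n [phi [b [h1 h2 h3 h4 h5]]]].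
    exists (fun y => al + rc r * y), (rc r); split=> //.
    - exact: analytic_affine.
    - by rewrite mulr0 addr0.
    - exact: slope0_affine.
    - by rewrite big_nil mulr1.
  have phic y : disc y -> phi y != c.
    by move=> yD; apply/eqP => yc; apply: nohit; exists n, phi; split=> //; exists y.
  have [|psi [k1 k2 k3 k4]] := disc_lift h1 phic (a := z n.+1); first by rewrite h2 -(hz n).
  have zn0 : z n.+1 != 0.
    have := phic 0 (@disc0 R); rewrite h2 -(hz n) /quad.
    by apply: contraNneq => ->; rewrite expr0n add0r.
  exists psi, (b / (2 * z n.+1)); split=> //.
  - by move=> y yD; rewrite iterSr -h3// -k3.
  - exact: k4.
  - rewrite big_nat_recr//= -h5; field.
    exact: zn0.
pose P n := \prod_(0 <= i < n) (2 * z i.+1).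
have PE n : P (p * n)%N = multiplier c p al al ^+ n.
  elim: n => [|n IH]; first by rewrite muln0 /P big_nil expr0.
  rewrite mulnS addnC /P (@big_cat_nat _ _ _ (p * n)%N)//= ?leq_addr//.
  rewrite -/(P _) IH exprSr; congr (_ * _).
  rewrite -{1}[(p * n)%N]add0n big_addn addKn big_mkord /multiplier.
  (* A backward orbit goes around the cycle in the opposite order to [multiplier]. *)
  rewrite (reindex_inj rev_ord_inj); apply: eq_bigr => i _ /=.
  have -> : ((p - i.+1 + p * n).+1 = p * n + (p - i))%N.
    by rewrite subnS; have := ltn_ord i; lia.
  have := iter_backward hz i (p * n + (p - i))%N.
  have -> : (p * n + (p - i) + i = p * n.+1)%N by have := ltn_ord i; rewrite mulnS; lia.
  by rewrite hp => <-; ring.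
pose B : R := 2 + nm c + nm al + r.
have B0 : 0 < B by rewrite /B; have := nm_ge0 c; have := nm_ge0 al; lra.
have bd n phi : (forall y, disc y -> iter n (quad c) (phi y) = al + rc r * y) ->
    forall y, disc y -> nm (phi y) <= B.
  move=> h y yD; apply: (@nm_iter_quad_le c n); first by rewrite /B; have := nm_ge0 al; lra.
  rewrite h//; apply: le_trans (nmD _ _) _; rewrite nmM nm_rc ger0_norm ?(ltW r0)//.
  rewrite /B; move: yD; rewrite /disc /=; have := nm_ge0 c; nra.
(* After [n] turns the slope [b] satisfies [nm b * nm (multiplier c p al al) ^+ n = r], while
   Schwarz's lemma gives [nm b <= 2 * B]; this [n] makes the two incompatible. *)
have [n hn] := geometric_small (nm_ge0 _) hk (divr_gt0 r0 (mulr_gt0 (ltr0Sn R 1) B0)).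
have [phi [b [h1 h2 h3 h4 h5]]] := key (p * n)%N.
have := slope0_bound h1 h4 (bd _ _ h3).
have := congr1 (@nm R) h5; rewrite -/(P _) PE nmM nmX nm_rc ger0_norm ?(ltW r0)//.
move: hn; rewrite ltr_pdivlMr ?mulr_gt0// => hn h6 h7.
have := ler_wpM2r (exprn_ge0 n (nm_ge0 (multiplier c p al al))) h7; lra.
Qed.

End inverse_branches.

(** * Uniform estimates and attraction of the critical orbit *)

Section trapping.
Context {R : realType}.
Implicit Types (c x y z w : Cplx R) (e t k r B L : R).

Lemma quad_lip c c' x x' B : nm x <= B -> nm x' <= B ->
  nm (quad c' x' - quad c x) <= 2 * B * nm (x' - x) + nm (c' - c).
Proof.
move=> xB x'B; have -> : quad c' x' - quad c x = (x' - x) * (x' + x) + (c' - c).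
  by rewrite /quad; ring.
apply: le_trans (nmD _ _) _; rewrite nmM lerD2r mulrC; apply: ler_wpM2r; first exact: nm_ge0.
by apply: le_trans (nmD _ _) _; lra.
Qed.

Lemma iter_quad_bound n B : 0 <= B -> exists2 B', 0 <= B' &
  forall c x, nm c <= B -> nm x <= B -> nm (iter n (quad c) x) <= B'.
Proof.
move=> B0; elim: n => [|n [B' B'0 h]]; first by exists B.
exists (B' ^+ 2 + B); first by have := sqr_ge0 B'; lra.
move=> c x cB xB; rewrite /= /quad; apply: le_trans (nmD _ _) _.
by apply: lerD => //; rewrite nmX ler_pXn2r ?nnegrE ?nm_ge0// h.
Qed.

Lemma iter_quad_lip N B : 0 <= B -> exists2 L, 0 < L &
  forall n, (n <= N)%N -> forall c c' x x', nm c <= B -> nm c' <= B -> nm x <= B -> nm x' <= B ->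
    nm (iter n (quad c') x' - iter n (quad c) x) <= L * (nm (x' - x) + nm (c' - c)).
Proof.
move=> B0; elim: N => [|N [L L0 IH]].
  exists 1 => // n; rewrite leqn0 => /eqP-> c c' x x' *; rewrite mul1r /=.
  by have := nm_ge0 (c' - c); lra.
have [B' B'0 hB'] := iter_quad_bound N B0.
exists (L + (2 * B' * L + 1)); first by have := mulr_ge0 B'0 (ltW L0); lra.
move=> n; rewrite leq_eqVlt => /orP[/eqP->|]; last first.
  rewrite ltnS => nN c c' x x' h1 h2 h3 h4; apply: le_trans (IH n nN _ _ _ _ h1 h2 h3 h4) _.
  apply: ler_wpM2r; first by rewrite addr_ge0 ?nm_ge0.
  by have := mulr_ge0 B'0 (ltW L0); lra.
move=> c c' x x' h1 h2 h3 h4.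
apply: le_trans (quad_lip _ _ (hB' _ _ h1 h3) (hB' _ _ h2 h4)) _.
have := IH N (leqnn N) _ _ _ _ h1 h2 h3 h4 => /(ler_wpM2l B'0).
have := nm_ge0 (x' - x); have := nm_ge0 (c' - c); move: (nm (x' - x)) (nm (c' - c)) => a b b0 a0.
have := mulr_ge0 (ltW L0) (addr_ge0 a0 b0); lra.
Qed.

Lemma multiplier_lip p B : 0 <= B -> exists2 L, 0 < L &
  forall c c' x x' y y', nm c <= B -> nm c' <= B -> nm x <= B -> nm x' <= B ->
    nm y <= B -> nm y' <= B ->
    nm (multiplier c' p x' y' - multiplier c p x y) <=
      L * (nm (x' - x) + nm (y' - y) + nm (c' - c)) /\ nm (multiplier c p x y) <= L.
Proof.
move=> B0; elim: p => [|p [L L0 IH]].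
  exists 1 => // *; rewrite /multiplier !big_ord0 subrr nm0 nm1 mul1r.
  by rewrite !addr_ge0 ?nm_ge0.
have [B' B'0 hB'] := iter_quad_bound p B0.
have [L' L'0 hL'] := iter_quad_lip p B0.
have LL := mulr_gt0 L0 L'0; have LB := mulr_ge0 (ltW L0) B'0.
exists (2 * (L * L') + 2 * (L * B') + 1); first lra.
move=> c c' x x' y y' h1 h2 h3 h4 h5 h6.
have [i1 i2] := IH _ _ _ _ _ _ h1 h2 h3 h4 h5 h6.
have j1 := hL' p (leqnn p) _ _ _ _ h1 h2 h3 h4.
have j2 := hL' p (leqnn p) _ _ _ _ h1 h2 h5 h6.
rewrite /multiplier !big_ord_recr /= -!/(multiplier _ _ _ _).
have b1 := hB' _ _ h1 h3; have b2 := hB' _ _ h1 h5.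
have b3 := hB' _ _ h2 h4; have b4 := hB' _ _ h2 h6.
move: (iter p (quad c') x') (iter p (quad c') y') (iter p (quad c) x) (iter p (quad c) y)
  j1 j2 b1 b2 b3 b4 => X' Y' X Y j1 j2 b1 b2 b3 b4.
move: (multiplier c' p x' y') (multiplier c p x y) i1 i2 => M' M i1 i2.
split; last first.
  rewrite nmM; apply: (@le_trans _ _ (L * (2 * B'))); last lra.
  apply: ler_pM; rewrite ?nm_ge0//; apply: le_trans (nmD _ _) _; lra.
have -> : M' * (X' + Y') - M * (X + Y) = (M' - M) * (X' + Y') + M * ((X' - X) + (Y' - Y)) by ring.
apply: le_trans (nmD _ _) _; rewrite !nmM.
have s1 := nmD X' Y'; have s2 := nmD (X' - X) (Y' - Y).
have := nm_ge0 (x' - x); have := nm_ge0 (y' - y); have := nm_ge0 (c' - c).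
move: (nm (x' - x)) (nm (y' - y)) (nm (c' - c)) i1 j1 j2 => a b d i1 j1 j2 d0 b0 a0.
have k1 : nm (M' - M) * nm (X' + Y') <= L * (a + b + d) * (2 * B').
  apply: ler_pM; rewrite ?nm_ge0//; lra.
have k2 : nm M * nm (X' - X + (Y' - Y)) <= L * (L' * (a + b + 2 * d)).
  apply: ler_pM; rewrite ?nm_ge0//; lra.
have := mulr_ge0 (ltW LL) a0; have := mulr_ge0 (ltW LL) b0; have := mulr_ge0 (ltW LL) d0.
lra.
Qed.

Lemma bernoulli_sub (s : R) n : 0 <= s -> s <= 1 -> 1 - n%:R * s <= (1 - s) ^+ n.
Proof.
move=> s0 s1; elim: n => [|n IH]; first by rewrite mul0r expr0; lra.
rewrite exprS -natr1; have n0 : 0 <= n%:R :> R by [].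
have := mulr_ge0 n0 (sqr_ge0 s); rewrite expr2.
have : (1 - s) * (1 - n%:R * s) <= (1 - s) * (1 - s) ^+ n by apply: ler_wpM2l => //; lra.
lra.
Qed.

(** Distributes a contraction by [k] over [n] single steps. The choice of [s] gives
    [1 - n%:R * s = k + 2 * s], so Bernoulli's inequality yields [k <= (1 - s) ^+ n]. *)
Lemma root_above1 k n : 0 <= k -> k < 1 -> exists2 t, 1 < t & t ^+ n * k <= 1.
Proof.
move=> k0 k1; pose s : R := (1 - k) / (n%:R + 2).
have n0 : 0 <= n%:R :> R by [].
have s0 : 0 < s by apply: divr_gt0; lra.
have sn : s * (n%:R + 2) = 1 - k by rewrite divfK//; lra.
have s1' : s < 1 by have := mulr_ge0 (ltW s0) n0; lra.
exists (1 - s)^-1; first by rewrite invf_gt1; lra.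
have s'0 : 0 < 1 - s by lra.
rewrite exprVn mulrC ler_pdivrMr ?exprn_gt0//.
have := @bernoulli_sub s n (ltW s0) (ltW s1'); have := mulr_ge0 (ltW s0) n0; lra.
Qed.


(** For a backward orbit the values at the indices [j + p * n] determine all those in between by
    forward iteration, so the tail from [j] on runs along an attracting cycle. *)
Definition attracted_backward c (z : nat -> Cplx R) :=
  exists j p al, [/\ (0 < p)%N, forall n, z (j + p * n)%N = al &
    nm (multiplier c p al al) < 1].

(** Pigeonhole on residues: if each class had a failure [f], a member of [A] beyond all of them
    would descend, within its own class, to the failing index. *)
Lemma backward_residue (A : nat -> Prop) p : (0 < p)%N ->
  (forall N, exists2 j, (N <= j)%N & A j) -> (forall j, A (j + p)%N -> A j) ->
  exists j, forall n, A (j + p * n)%N.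
Proof.
move=> p0 inf down; apply: contrapT => /forallNP nh.
have /choice[f hf] j : exists n, ~ A (j + p * n)%N by exact/existsNP/nh.
have down' j n m : (n <= m)%N -> A (j + p * m)%N -> A (j + p * n)%N.
  move=> /subnKC <-; elim: (m - n)%N => [|d IH]; first by rewrite addn0.
  have -> : (j + p * (n + d.+1) = j + p * (n + d) + p)%N by rewrite addnS mulnS; lia.
  by move=> /down /IH.
have [j hj Aj] := inf (p * \sum_(i < p) f i + p)%N.
have jm : (j %% p < p)%N by rewrite ltn_mod.
apply: (hf (j %% p)%N); apply: (down' _ _ (j %/ p)%N); last first.
  by rewrite addnC mulnC -divn_eq.
apply: (@leq_trans (\sum_(i < p) f i)%N).
  by rewrite (bigD1 (Ordinal jm))//= leq_addr.
rewrite leq_divRL// mulnC; apply: leq_trans hj; exact: leq_addr.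
Qed.

Lemma critical_orbit_attracted c p (al : Cplx R) k r e : (0 < p)%N ->
  iter p (quad c) al = al -> 0 <= k -> k < 1 -> 0 < r -> 0 < e ->
  (forall x y, nm (x - al) <= r -> nm (y - al) <= r -> nm (multiplier c p x y) <= k) ->
  exists n, nm (iter n (quad c) 0 - al) <= e.
Proof.
move=> p0 pal k0 k1 r0 e0 hk.
have alr : nm (al - al) <= r by rewrite subrr nm0 ltW.
(* On the cycle, one step back is [p.-1] steps forward. *)
pose z n := iter (p.-1 * n) (quad c) al.
have itp n : iter (p * n) (quad c) al = al.
  by elim: n => [|n IH]; rewrite ?muln0// mulnS iterD IH.
have hz n : quad c (z n.+1) = z n.
  rewrite /z -iterS; have -> : ((p.-1 * n.+1).+1 = p.-1 * n + p)%N.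
    by rewrite mulnS; case: p p0 {pal hk z itp} => // p _ /=; rewrite addnC addnS.
  by rewrite iterD pal.
have zp n : z (p * n)%N = al by rewrite /z mulnCA itp.
have mk : nm (multiplier c p al al) < 1 by apply: le_lt_trans k1; exact: hk.
have [n [phi [_ _ h [y yD yc]]]] := backward_hits_critical_value hz zp mk r0.
have n1 : nm (iter n.+1 (quad c) 0 - al) <= r.
  rewrite iterSr; have -> : quad c 0 = c by rewrite /quad expr0n add0r.
  have -> : iter n (quad c) c = al + rc r * y by rewrite -h// yc.
  rewrite addrC addKr nmM nm_rc ger0_norm ?(ltW r0)//.
  by move: yD; rewrite /disc /=; nra.
have contr m : nm (iter (p * m + n.+1) (quad c) 0 - al) <= k ^+ m * r.
  elim: m => [|m IH]; first by rewrite muln0 expr0 mul1r.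
  rewrite mulnS -addnA iterD -{1}pal iter_quadB nmM exprS -mulrA mulrC.
  apply: ler_pM; rewrite ?nm_ge0//; apply: hk => //.
  apply: le_trans IH _; rewrite ler_piMl ?(ltW r0)//.
  by apply: exprn_ile1 => //; exact: ltW.
have [m hm] := geometric_small k0 k1 (divr_gt0 e0 r0).
exists (p * m + n.+1)%N; apply: le_trans (contr m) _.
by rewrite -ler_pdivlMr// ltW.
Qed.

End trapping.

(** * Construction of the trap around infinity and the attracting cycle *)

Section trap.
Context {R : realType}.
Implicit Types (c x y z w : Cplx R) (e t k r B L : R) (W : set (Cplx R)).

(* [W] is the complement of a neighbourhood of infinity and of a
   neighbourhood of the attracting cycle that contains the critical point. *)
Record trap c W (B eta eta0 d0 : R) : Prop := Trap {
  trap_B : 0 < B;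
  trap_eta : 0 < eta;
  trap_eta0 : 0 < eta0;
  trap_d0 : 0 < d0;
  trap_bound : forall z, W z -> nm z <= B;
  trap_inner : forall x y, W y -> nm (quad c x - y) <= d0 ->
    forall x', nm (x' - x) <= eta -> W x';
  trap_crit : forall x, W x -> eta0 <= nm x;
  trap_out : forall c' (z : nat -> Cplx R), nm (c' - c) <= d0 ->
    (forall n, quad c' (z n.+1) = z n) -> (forall n, ~ W (z n)) ->
    attracted_backward c' z }.

Lemma uniform_contraction c p (al : Cplx R) : nm (multiplier c p al al) < 1 ->
  exists k r, [/\ 0 <= k, k < 1, 0 < r, r <= 1 & forall c' x y, nm (c' - c) <= r ->
    nm (x - al) <= r -> nm (y - al) <= r -> nm (multiplier c' p x y) <= k].
Proof.
move=> mal; have m0 := nm_ge0 (multiplier c p al al).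
have [k [k0 k1 mk]] : exists k, [/\ 0 <= k, k < 1 & nm (multiplier c p al al) < k].
  by exists ((1 + nm (multiplier c p al al)) / 2); split; lra.
have c0 := nm_ge0 c; have al0 := nm_ge0 al.
have B0 : 0 <= 1 + nm c + nm al by lra.
have [L L0 hL] := multiplier_lip p B0.
have e10 : 0 < (k - nm (multiplier c p al al)) / (3 * L) by apply: divr_gt0; lra.
have [r [r0 r1 rL]] := small2 ltr01 e10.
exists k, r; split=> // c' x y c'c xal yal.
have h (u v : Cplx R) : nm (u - v) <= r -> nm v <= nm c + nm al -> nm u <= 1 + nm c + nm al.
  by move=> h1 h2; have := nmD (u - v) v; rewrite subrK; lra.
have b1 : nm c <= 1 + nm c + nm al by lra.
have b2 : nm al <= 1 + nm c + nm al by lra.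
have b3 : nm c' <= 1 + nm c + nm al by apply: h c'c _; lra.
have b4 : nm x <= 1 + nm c + nm al by apply: h xal _; lra.
have b5 : nm y <= 1 + nm c + nm al by apply: h yal _; lra.
have [h1 _] := hL _ _ _ _ _ _ b1 b3 b2 b4 b2 b5.
move: {h hL b1 b2 b3 b4 b5} h1.
have : L * (nm (x - al) + nm (y - al) + nm (c' - c)) <= L * (3 * r).
  by apply: ler_wpM2l; lra.
have := nmB_ge (multiplier c' p x y) (multiplier c p al al).
by move: rL; rewrite ler_pdivlMr; lra.
Qed.

Lemma quad_grow c c' x : nm (c' - c) <= 1 -> 4 + nm c <= nm x ->
  2 * nm x <= nm (quad c' x) /\ nm x + 3 <= nm (quad c' x).
Proof.
move=> c'c hx; have : nm c' <= nm c + 1 by have := nmD (c' - c) c; rewrite subrK; lra.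
have := nmB_ge (x ^+ 2) (- c'); rewrite opprK nmN nmX -/(quad c' x).
have := nm_ge0 c; move: hx; move: (nm x) (nm c') (nm c) (nm (quad c' x)) => X C' C Q hX h1 h2 h3.
have : (4 + C) * X <= X ^+ 2 by rewrite expr2; apply: ler_wpM2r; lra.
have : 0 <= C * X by apply: mulr_ge0; lra.
by split; lra.
Qed.

(** A backward orbit that recurs in the contracting disc stays there along one residue class. Two
    successive points of that class are the images, after [m] turns, of two points at distance at
    most [2 * r]; as [m] is arbitrary, they coincide. *)
Lemma recurrent_attracted_backward c p (al : Cplx R) k r (z : nat -> Cplx R) : (0 < p)%N ->
  0 <= k -> k < 1 ->
  (forall x y, nm (x - al) <= r -> nm (y - al) <= r -> nm (multiplier c p x y) <= k) ->
  (forall x, nm (x - al) <= r -> nm (iter p (quad c) x - al) <= r) ->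
  (forall n, quad c (z n.+1) = z n) ->
  (forall N, exists2 j, (N <= j)%N & nm (z j - al) <= r) -> attracted_backward c z.
Proof.
move=> p0 k0 k1 hk hr hz inf.
have down j : nm (z (j + p)%N - al) <= r -> nm (z j - al) <= r.
  by move=> /hr; rewrite iter_backward.
have [j hj] := backward_residue p0 inf down.
have r0 : 0 <= r by apply: le_trans (nm_ge0 _) (hj 0%N).
have step n m : nm (z (j + p * n)%N - z (j + p * n.+1)%N) <= k ^+ m * (2 * r).
  elim: m n => [|m IH] n.
    rewrite expr0 mul1r; have := nm_triangle al (z (j + p * n)%N) (z (j + p * n.+1)%N).
    by have := hj n; have := hj n.+1; rewrite (nmB al); lra.
  have e1 i : z (j + p * i)%N = iter p (quad c) (z (j + p * i.+1)%N).
    by rewrite mulnS [(p + _)%N]addnC addnA iter_backward.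
  rewrite e1 [in X in _ - X]e1 iter_quadB nmM exprS -mulrA mulrC.
  by apply: ler_pM; rewrite ?nm_ge0//; exact: hk.
have eq n : z (j + p * n)%N = z (j + p * n.+1)%N.
  apply: nm_le_eq => e e0.
  have r1 : 0 < 2 * r + 1 by lra.
  have [m hm] := geometric_small k0 k1 (divr_gt0 e0 r1).
  apply: le_trans (step n m) _; move: hm; rewrite ltr_pdivlMr// => hm.
  by have := exprn_ge0 m k0; lra.
exists j, p, (z j); split=> //.
- by elim=> [|n IH]; rewrite ?muln0 ?addn0// -eq.
- by apply: le_lt_trans k1; apply: hk; have := hj 0%N; rewrite muln0 addn0.
Qed.


(** The complement of a neighbourhood of the cycle in an adapted distance. The multiplier contracts
    only over [p] steps; the weights [th ^+ i] turn this into a contraction at every step. The delay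
    [n0] enlarges the neighbourhood until it contains the critical point. *)
Definition off_cycle c p (al : Cplx R) n0 (th rho : R) : set (Cplx R) := [set z |
  forall i, (i < p)%N -> rho < th ^+ i * nm (iter (n0 + i) (quad c) z - al)].

Lemma off_cycleN c p (al : Cplx R) n0 (th rho : R) z : ~ off_cycle c p al n0 th rho z ->
  exists2 i, (i < p)%N & th ^+ i * nm (iter (n0 + i) (quad c) z - al) <= rho.
Proof.
move=> h; apply: contrapT => nh; apply: h => i ip; rewrite ltNge; apply/negP => h.
by apply: nh; exists i.
Qed.

Lemma off_cycle_stable c p (al : Cplx R) n0 (th rho s L B : R) x y : 1 <= th ->
  (forall n, (n <= n0 + p)%N -> forall x x', nm x <= B -> nm x' <= B ->
    nm (iter n (quad c) x' - iter n (quad c) x) <= L * nm (x' - x)) ->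
  0 <= L -> nm x <= B -> nm y <= B -> th ^+ p * (L * nm (y - x)) + s <= rho ->
  off_cycle c p al n0 th rho y -> off_cycle c p al n0 th s x.
Proof.
move=> th1 hL L0 xB yB hs hy i ip; have := hy i ip.
have t0 : 0 <= th ^+ i by apply: exprn_ge0; lra.
have tT : th ^+ i <= th ^+ p by rewrite ler_weXn2l// ltnW.
have iN : (n0 + i <= n0 + p)%N by rewrite leq_add2l ltnW.
have h1 := hL _ iN _ _ xB yB.
have h2 := nm_triangle (iter (n0 + i) (quad c) x) (iter (n0 + i) (quad c) y) al.
have h3 : th ^+ i * (L * nm (y - x)) <= th ^+ p * (L * nm (y - x)).
  by apply: ler_wpM2r => //; rewrite mulr_ge0 ?nm_ge0.
have := ler_wpM2l t0 (le_trans h2 (lerD h1 (lexx _))).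
rewrite mulrDr; move: hs h3; clear; lra.
Qed.

(* One step of the dynamics multiplies the weighted distance to the cycle by
   at most [th^-1]. *)
Lemma off_cycle_preimage c p (al : Cplx R) n0 (k r th s : R) x : (0 < p)%N ->
  iter p (quad c) al = al -> 0 <= k -> 1 <= th -> th ^+ p * k <= 1 -> 0 <= s -> th * s <= r ->
  (forall x y, nm (x - al) <= r -> nm (y - al) <= r -> nm (multiplier c p x y) <= k) ->
  off_cycle c p al n0 th s (quad c x) -> off_cycle c p al n0 th (th * s) x.
Proof.
move=> p0 pal k0 th1 thk s0 sr hk hx i ip; rewrite ltNge; apply/negP => hi.
(* A violation at index 0 becomes one at index [p.-1] after a whole turn, where [th ^+ p * k <= 1]
   pays for the weight; one at index [i.+1] becomes one at index [i] and gains the factor [th]. *)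
case: i ip hi => [|i] ip hi.
  have p1 : (p.-1 < p)%N by rewrite ltn_predL.
  have := hx _ p1; rewrite ltNge => /negP; apply.
  have -> : iter (n0 + p.-1) (quad c) (quad c x) = iter p (quad c) (iter n0 (quad c) x).
    by rewrite -iterSr -iterD -addnS prednK// addnC.
  rewrite expr0 mul1r addn0 in hi; rewrite -{1}pal iter_quadB nmM.
  have r0 : 0 <= r by apply: le_trans sr; rewrite mulr_ge0//; lra.
  have h1 : nm (multiplier c p (iter n0 (quad c) x) al) <= k.
    by apply: hk; rewrite ?subrr ?nm0//; exact: le_trans hi sr.
  have t0 : 0 <= th ^+ p.-1 by apply: exprn_ge0; lra.
  have h2 : nm (iter n0 (quad c) x - al) * nm (multiplier c p (iter n0 (quad c) x) al) <= th * s * k.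
    by apply: ler_pM; rewrite ?nm_ge0.
  apply: le_trans (ler_wpM2l t0 h2) _.
  have -> : th ^+ p.-1 * (th * s * k) = s * (th ^+ p * k).
    by rewrite -[in RHS](prednK p0) exprS; ring.
  by rewrite ler_piMr.
have := hx _ (ltnW ip); rewrite ltNge => /negP; apply.
rewrite -iterSr -addnS; rewrite exprS -mulrA ler_pM2l// in hi; lra.
Qed.

Lemma trap_exists c p (al : Cplx R) : (0 < p)%N -> iter p (quad c) al = al ->
  nm (multiplier c p al al) < 1 -> exists W B eta eta0 d0, trap c W B eta eta0 d0.
Proof.
move=> p0 pal mal.
have [k [r [k0 k1 r0 r1 hk]]] := uniform_contraction mal.
have c0 := nm_ge0 c; have al0 := nm_ge0 al.
have [Rd RdE] : exists Rd, Rd = 5 + nm c + nm al by eexists.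
have Rd1 : 0 <= Rd + 1 by lra.
have [th th1 thk] := @root_above1 R k p k0 k1.
have [rho rho0 rhoE] : exists2 rho, 0 < rho & rho * th = r.
  have t0 : 0 < th by lra.
  by exists (r / th); [exact: divr_gt0 | rewrite divfK// gt_eqF].
have rho2 : 0 < rho / 2 by lra.
have hkc x y : nm (x - al) <= r -> nm (y - al) <= r -> nm (multiplier c p x y) <= k.
  by apply: hk; rewrite subrr nm0 ltW.
(* Only half of [rho] is spent on the critical orbit; [eta'] uses the other half to keep a whole
   disc about 0 out of [W]. *)
have [n0 hn0] := critical_orbit_attracted p0 pal k0 k1 r0 rho2 hkc.
have [L L0 hL] := iter_quad_lip (n0 + p) Rd1.
have cB : nm c <= Rd + 1 by lra.
have hLc n : (n <= n0 + p)%N -> forall x x', nm x <= Rd + 1 -> nm x' <= Rd + 1 ->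
    nm (iter n (quad c) x' - iter n (quad c) x) <= L * nm (x' - x).
  by move=> nN x x' h1 h2; have := hL _ nN _ _ _ _ cB cB h1 h2; rewrite subrr nm0 addr0.
pose W := [set z : Cplx R | nm z < Rd] `&` off_cycle c p al n0 th rho.
have T0 : 0 < th ^+ p by apply: exprn_gt0; lra.
have TL := mulr_gt0 T0 L0.
(* [th * sig] is the midpoint of [rho] and [r = rho * th]. Levels go from [rho] down to [sig] when
   the image is moved by [d1], up to [th * sig] under the preimage, and down to [rho] when the
   preimage is moved by [eta]. *)
pose sig := rho * (1 + th) / (2 * th).
have sigE : sig * (2 * th) = rho * (1 + th) by rewrite divfK// gt_eqF//; lra.
have [sig0 sig1 sig2 sig3] : [/\ 0 < sig, sig < rho, rho < th * sig & th * sig <= r].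
  have h0 : 0 < rho * (th - 1) by apply: mulr_gt0; lra.
  have h1 : 0 < sig by apply: divr_gt0; [apply: mulr_gt0|]; lra.
  have h2 : sig < rho.
    rewrite -(@ltr_pM2r _ (2 * th)); last lra.
    by move: sigE h0; clear; lra.
  by move: sigE h0 h1 h2 rhoE; clear; split; lra.
have half0 : 0 < 2^-1 :> R by lra.
have m1 : 0 < th * sig - rho by lra.
have m2 : 0 < rho - sig by lra.
have [eta [eta0 eta1 eta2]] := small2 half0 (divr_gt0 m1 TL).
have [eta' [eta'0 eta'1 eta'2]] := small2 half0 (divr_gt0 rho2 L0).
have [d1 [d10 d11 d12]] := small2 half0 (divr_gt0 m2 TL).
have a3 : 0 < (1 - k) * r by apply: mulr_gt0; lra.
have a1 : 0 < r - rho by lra.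
(* For perturbed parameters, the first bound keeps the disc of radius [r] about [al] invariant under
   a turn, and the second makes points within [rho] of [al] land in that disc. *)
have [d2 [d20 d21 d22]] := small2 (divr_gt0 a3 L0) (divr_gt0 a1 L0).
have [d [d0 dd1 dd2 dr]] := small3 d10 d20 r0.
rewrite ler_pdivlMr// in eta2.
rewrite ler_pdivlMr// in eta'2.
rewrite ler_pdivlMr// in d12.
rewrite ler_pdivlMr// in d21.
rewrite ler_pdivlMr// in d22.
have th1' := ltW th1; have L0' := ltW L0; have T0' := ltW T0.
exists W, Rd, eta, eta', d.
split=> //.
- by move: RdE c0 al0; clear; lra.
- by move=> z [/ltW].
- move=> x y [yR yW] xy x' xx'.
  have xR : nm x < Rd - 2^-1.
    rewrite ltNge; apply/negP => h; have [||_ ] := @quad_grow c c x.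
    - by rewrite subrr nm0.
    - by move: h RdE al0; clear; lra.
    by have := nmB_ge (quad c x) y; move: h xy yR dd1 d11; rewrite /=; clear; lra.
  have x'R : nm x' < Rd by have := nmB_ge x' x; move: xR xx' eta1; clear; lra.
  have xB : nm x <= Rd + 1 by move: xR; clear; lra.
  have x'B : nm x' <= Rd + 1 by move: x'R; clear; lra.
  have yB : nm y <= Rd + 1 by move: yR; rewrite /=; clear; lra.
  have fxB : nm (quad c x) <= Rd + 1.
    by have := nmB_ge (quad c x) y; move: xy yR dd1 d11; rewrite /=; clear; lra.
  split=> //.
  have fx : off_cycle c p al n0 th sig (quad c x).
    apply: (off_cycle_stable th1' hLc L0' fxB yB _ yW).
    have h : th ^+ p * (L * nm (y - quad c x)) <= th ^+ p * (L * d1).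
      by do 2! apply: ler_wpM2l => //; rewrite nmB; exact: le_trans xy dd1.
    by move: h d12; clear; lra.
  have xW := off_cycle_preimage p0 pal k0 th1' thk (ltW sig0) sig3 hkc fx.
  apply: (off_cycle_stable th1' hLc L0' x'B xB _ xW).
  have h : th ^+ p * (L * nm (x - x')) <= th ^+ p * (L * eta).
    by do 2! apply: ler_wpM2l => //; rewrite nmB.
  by move: h eta2; clear; lra.
- move=> x [xR xW]; rewrite leNgt; apply/negP => hx.
  have := xW 0%N p0; rewrite addn0 expr0 mul1r ltNge => /negP; apply.
  have xB : nm x <= Rd + 1 by move: xR; rewrite /=; clear; lra.
  have oB : nm (0 : Cplx R) <= Rd + 1 by rewrite nm0.
  have := hLc _ (leq_addr p n0) _ _ oB xB; rewrite subr0.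
  have := nm_triangle (iter n0 (quad c) 0) (iter n0 (quad c) x) al.
  have := ler_wpM2l L0' (ltW hx).
  by move: eta'2 hn0; clear; lra.
- move=> c' z c'c hz hW.
  have c'1 : nm (c' - c) <= 1 by move: c'c dd1 d11; clear; lra.
  have cr : nm (c' - c) <= r by move: c'c dr; clear; lra.
  have alB : nm al <= Rd + 1 by move: RdE c0; clear; lra.
  have c'B : nm c' <= Rd + 1 by have := nmB_ge c' c; move: c'1 RdE al0; clear; lra.
  have Ld : L * nm (c' - c) <= L * d2 by apply: ler_wpM2l => //; exact: le_trans c'c dd2.
  have grow x : Rd <= nm x -> 2 * nm x <= nm (quad c' x) /\ nm x + 3 <= nm (quad c' x).
    by move=> hx; apply: quad_grow c'1 _; move: hx RdE al0; clear; lra.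
  (* Beyond [Rd] the map at least doubles the modulus, so a backward orbit cannot remain there. *)
  have [m hm] : exists m, nm (z m) < Rd.
    apply: contrapT => /forallNP nh.
    have big n : Rd <= nm (z n) by rewrite leNgt; apply/negP.
    have Rd5 : 5 <= Rd by move: RdE al0 c0; clear; lra.
    move: hz grow big Rd5; clear => hz grow big Rd5.
    have dec n : nm (z n) <= 2^-1 ^+ n * nm (z 0%N).
      elim: n => [|n IH]; first by rewrite expr0 mul1r.
      have [h _] := grow _ (big n.+1); rewrite hz in h.
      by rewrite exprS -mulrA; lra.
    have z0 : 0 < nm (z 0%N) + 1 by have := nm_ge0 (z 0%N); lra.
    have h0 : 0 <= 2^-1 :> R by lra.
    have h1 : 2^-1 < 1 :> R by lra.
    have [n hn] := geometric_small h0 h1 (divr_gt0 ltr01 z0).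
    have := dec n; have := big n; move: hn; rewrite ltr_pdivlMr//.
    by have := exprn_ge0 n h0; lra.
  have small n : (m <= n)%N -> nm (z n) < Rd.
    move=> /subnKC <-; elim: (n - m)%N => [|i IH]; first by rewrite addn0.
    rewrite addnS ltNge; apply/negP => /[dup] h /grow [_]; rewrite hz.
    by move: IH h; clear; lra.
  apply: (recurrent_attracted_backward p0 k0 k1 (fun x y => hk c' x y cr)) => //.
    move=> x xal; have xB : nm x <= Rd + 1.
      by have := nmB_ge x al; move: xal r1 RdE c0; clear; lra.
    have := nm_triangle (iter p (quad c') al) (iter p (quad c') x) (iter p (quad c) al).
    have := hL _ (leq_addl n0 p) _ _ _ _ cB c'B alB alB.
    rewrite subrr nm0 add0r pal iter_quadB nmM.
    have h1 : nm (multiplier c' p x al) <= k by apply: hk => //; rewrite subrr nm0 ltW.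
    have : nm (x - al) * nm (multiplier c' p x al) <= r * k by apply: ler_pM; rewrite ?nm_ge0.
    by move: d21 Ld; clear; lra.
  (* Iterating [n0 + i] times forward from [z n], with [i < p], lowers the index by as much and must
     still leave it at least [N]. *)
  move=> N; pose n := (N + n0 + p + m)%N.
  have zn : nm (z n) < Rd by apply: small; rewrite leq_addl.
  have zB : nm (z n) <= Rd + 1 by move: zn; clear; lra.
  have [|i ip hi] := @off_cycleN c p al n0 th rho (z n).
    by move=> h; apply: (hW n).
  exists (n - (n0 + i))%N; first by rewrite /n; clear -ip; lia.
  have e1 : (n - (n0 + i) + (n0 + i) = n)%N by apply: subnK; rewrite /n; clear -ip; lia.
  have := iter_backward hz (n0 + i) (n - (n0 + i))%N; rewrite e1 => <-.
  have iN : (n0 + i <= n0 + p)%N by rewrite leq_add2l ltnW.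
  have := hL _ iN _ _ _ _ cB c'B zB zB; rewrite subrr nm0 add0r.
  have := nm_triangle (iter (n0 + i) (quad c) (z n)) (iter (n0 + i) (quad c') (z n)) al.
  have : nm (iter (n0 + i) (quad c) (z n) - al) <= rho.
    by apply: le_trans hi; rewrite ler_peMl ?nm_ge0// exprn_ege1.
  by move: d22 Ld; clear; lra.
Qed.

End trap.

(** * The Kobayashi metric and uniform expansion *)

Section kobayashi.
Context {R : realType}.
Implicit Types (c x y z w a b : Cplx R) (W : set (Cplx R)).

Definition disc_slopes W x : set R := [set s | exists phi a,
  [/\ analytic_disc phi, phi 0 = x, forall y, disc y -> W (phi y), slope0 phi a & s = nm a]].

(* The reciprocal of the infinitesimal Kobayashi metric of [W]. *)
Definition kappa W x : R := sup (disc_slopes W x).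

Variables (c0 : Cplx R) (W : set (Cplx R)) (B eta eta0 d0 : R).
Hypothesis tr : trap c0 W B eta eta0 d0.

Lemma disc_slopes_ub x s : disc_slopes W x s -> s <= 2 * B.
Proof.
move=> [phi [a [h1 h2 h3 h4 ->]]]; apply: slope0_bound h1 h4 _ => y yD.
exact/(trap_bound tr)/h3.
Qed.

Lemma kappa_ge x s : disc_slopes W x s -> s <= kappa W x.
Proof.
by move=> h; apply: ub_le_sup => //; exists (2 * B) => t; exact: disc_slopes_ub.
Qed.

Lemma disc_slopes0 x : W x -> disc_slopes W x 0.
Proof.
move=> Wx; exists (fun z => x + 0 * z), 0; split=> //.
- exact: analytic_affine.
- by rewrite mul0r addr0.
- by move=> y _; rewrite mul0r addr0.
- exact: slope0_affine.
- by rewrite nm0.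
Qed.

Lemma kappa_le x : kappa W x <= 2 * B.
Proof.
(* Without any disc centred at [x], as happens outside [W], the supremum takes its default value
   0. *)
rewrite /kappa; have [->|/set0P ne] := eqVneq (disc_slopes W x) set0.
  by rewrite sup0; have := trap_B tr; lra.
by apply: ge_sup => // s; exact: disc_slopes_ub.
Qed.

Lemma kappa_ge_radius x e : 0 <= e -> (forall y, nm (y - x) <= e -> W y) -> e <= kappa W x.
Proof.
move=> e0 h; apply: kappa_ge; exists (fun z => x + rc e * z), (rc e); split.
- exact: analytic_affine.
- by rewrite mulr0 addr0.
- move=> y yD; apply: h; rewrite addrC addKr nmM nm_rc ger0_norm//.
  by move: yD; rewrite /disc /=; nra.
- exact: slope0_affine.
- by rewrite nm_rc ger0_norm.
Qed.

(** Discs in [W] therefore avoid the critical value, which is what allows them to be lifted. *)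
Lemma trap_not_critical_value : ~ W c0.
Proof.
move=> Wc; have : W 0.
  apply: (trap_inner tr Wc (x := 0)); last by rewrite subrr nm0 ltW// (trap_eta tr).
  by rewrite /quad expr0n add0r subrr nm0 ltW// (trap_d0 tr).
by move/(trap_crit tr); rewrite nm0; have := trap_eta0 tr; lra.
Qed.

Lemma aligned a (e : R) : 0 <= e -> exists t, nm t = e /\ nm (a + t) = nm a + e.
Proof.
move=> e0; have [->|a0] := eqVneq a 0.
  by exists (rc e); rewrite add0r nm0 add0r nm_rc ger0_norm.
have na : 0 < nm a by rewrite nm_gt0.
exists (rc (e / nm a) * a); split.
  by rewrite nmM nm_rc ger0_norm ?divfK ?gt_eqF// divr_ge0// ltW.
have -> : a + rc (e / nm a) * a = rc (1 + e / nm a) * a by rewrite rcD rc1 mulrDl mul1r.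
have h : 0 <= e / nm a by rewrite divr_ge0// ltW.
rewrite nmM nm_rc ger0_norm; last lra.
by rewrite mulrDl mul1r divfK// gt_eqF.
Qed.

(** The enlargement adds [eta / 2] to a slope, and [kappa] is at most [2 * B]; the rate subtracts
    the quotient of the two from 1. *)
Definition kobayashi_rate : R := 1 - eta / (4 * B).

(* Lifting a disc through [quad c0] lands in the preimage of [W], where there
   is room [eta] to enlarge it (the Earle-Hamilton trick). *)
Lemma kappa_contract x y z : quad c0 z = y -> W y -> nm (x - z) <= eta / 2 ->
  eta / 2 <= kappa W x /\ kappa W y <= kobayashi_rate * (nm (2 * z) * kappa W x).
Proof.
move=> zy Wy xz.
have eta_gt0 := trap_eta tr; have B_gt0 := trap_B tr.
have inn v u : W (quad c0 v) -> nm (u - v) <= eta -> W u.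
  by move=> h; apply: (trap_inner tr h); rewrite subrr nm0 ltW// (trap_d0 tr).
have z0 : z != 0.
  apply/eqP => z0; apply: trap_not_critical_value; move: Wy.
  by rewrite -zy z0 /quad expr0n add0r.
have key s : disc_slopes W y s -> exists a, s = nm (2 * z) * nm a /\ nm a + eta / 2 <= kappa W x.
  move=> [phi [b [h1 h2 h3 h4 ->]]].
  have phic u : disc u -> phi u != c0.
    by move=> uD; apply/eqP => e; apply: trap_not_critical_value; rewrite -e; exact: h3.
  have [|psi [k1 k2 k3 k4]] := disc_lift h1 phic (a := z); first by rewrite h2 -zy.
  exists (b / (2 * z)); split.
    by rewrite -nmM mulrCA divff ?mulr1// mulf_neq0// pnatr_eq0.
  have e2 : 0 <= eta / 2 by lra.
  have [t [t1 t2]] := aligned (b / (2 * z)) e2; rewrite -t2.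
  (* Half of the room [eta] recentres the disc at [x], the other half increases its slope; [t] is
     aligned with the slope so that the moduli add. *)
  apply: kappa_ge; exists (fun u => psi u + ((x - z) + t * u)), (b / (2 * z) + t); split=> //.
  - exact: analytic_addlin.
  - by rewrite k2 mulr0 addr0 addrC subrK.
  - move=> u uD; apply: (inn (psi u)); first by rewrite /quad k3//; exact: h3.
    rewrite addrAC subrr add0r; apply: le_trans (nmD _ _) _; rewrite nmM t1.
    by move: uD; rewrite /disc /=; nra.
  - exact/slope0_addlin/k4.
have e1 : eta / 2 <= kappa W x.
  have [a [_ h]] := key 0 (disc_slopes0 Wy); have := nm_ge0 a; lra.
split=> //; apply: ge_sup; first by exists 0; exact: disc_slopes0.
move=> s /key[a [-> ha]]; rewrite mulrCA; apply: ler_wpM2l; first exact: nm_ge0.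
rewrite /kobayashi_rate mulrBl mul1r.
have : eta / (4 * B) * kappa W x <= eta / 2.
  have -> : eta / 2 = eta / (4 * B) * (2 * B) by field; rewrite gt_eqF.
  by apply: ler_wpM2l; [apply: divr_ge0; lra | exact: kappa_le].
lra.
Qed.

Lemma kobayashi_rate_lt1 : kobayashi_rate < 1.
Proof.
have h : 0 < eta / (4 * B) by apply: divr_gt0; have := trap_eta tr; have := trap_B tr; lra.
by rewrite /kobayashi_rate; lra.
Qed.

End kobayashi.

(** * Shadowing and conjugacy of small perturbations *)

Section shadowing.
Context {R : realType}.
Implicit Types (c x y z w a b : Cplx R) (G : Cplx R -> Cplx R).
Variables (c0 : Cplx R) (W : set (Cplx R)) (B eta eta0 d0 : R).
Hypothesis tr : trap c0 W B eta eta0 d0.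

Local Notation f := (quad c0).
Local Notation kap := (kappa W).

(* [k] is the contraction rate of [kappa], [q] the tolerated nonlinearity at scale
   [e1], [eps] the width of the tube in units of [kappa], and [de] the size of the
   perturbation. *)
Record shadow_scales (k q e1 eps de : R) : Prop := ShadowScales {
  sc_k0 : 0 < k; sc_k1 : k < 1; sc_rate : kobayashi_rate B eta <= k;
  sc_q0 : 0 < q; sc_q1 : q < 1; sc_kq : k < (1 - q) ^+ 2;
  sc_e1 : 0 < e1; sc_e1eta : e1 <= eta / 8; sc_e1q : e1 <= q * eta0 / 2;
  sc_eps : 0 < eps; sc_epsB : eps * (2 * B) <= e1;
  sc_de : 0 < de; sc_ded0 : de <= d0; sc_deq : de <= q * eta0;
  sc_de1 : de <= (1 - q) * (2 * eta0) * e1;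
  sc_de2 : 2 * de <= (1 - q) * (2 * eta0) * (eps * (eta / 4));
  sc_de3 : 2 * de <= eps * eta * eta0 * ((1 - q) - k / (1 - q)) }.

Lemma shadow_scales_exist : exists k q e1 eps de, shadow_scales k q e1 eps de.
Proof.
have eta_gt0 := trap_eta tr; have B_gt0 := trap_B tr; have eta0_gt0 := trap_eta0 tr.
have d0_gt0 := trap_d0 tr; have rate1 := kobayashi_rate_lt1 tr.
have [k [k0 k1 rk]] : exists k, [/\ 0 < k, k < 1 & kobayashi_rate B eta <= k].
  have [h|h] := lerP (kobayashi_rate B eta) 2^-1; first by exists 2^-1; split; lra.
  by exists (kobayashi_rate B eta); split; lra.
(* This choice gives [(1 - q) ^+ 2 - k = ((1 - k) / 2) ^+ 2]. *)
pose q := (1 - k) / 2; have [q0 q1] : 0 < q /\ q < 1 by rewrite /q; split; lra.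
have kq : k < (1 - q) ^+ 2.
  have : 0 < ((1 - k) / 2) ^+ 2 by apply: exprn_gt0; lra.
  by rewrite /q !expr2; lra.
have g0 : 0 < (1 - q) - k / (1 - q).
  by rewrite subr_gt0 ltr_pdivrMr -?expr2//; lra.
have a1 : 0 < eta / 8 by lra.
have a2 : 0 < q * eta0 / 2 by apply: divr_gt0 => //; exact: mulr_gt0.
have [e1 [e10 e11 e12]] := small2 a1 a2.
pose eps := e1 / (2 * B).
have epsE : eps * (2 * B) = e1 by rewrite divfK// gt_eqF//; lra.
have eps0 : 0 < eps by apply: divr_gt0; lra.
have b1 : 0 < q * eta0 by exact: mulr_gt0.
have b2 : 0 < (1 - q) * (2 * eta0) * e1 by do 2! apply: mulr_gt0 => //; lra.
have b3 : 0 < (1 - q) * (2 * eta0) * (eps * (eta / 4)) / 2.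
  by apply: divr_gt0 => //; apply: mulr_gt0; apply: mulr_gt0; lra.
have b4 : 0 < eps * eta * eta0 * ((1 - q) - k / (1 - q)) / 2.
  by apply: divr_gt0 => //; do 3! apply: mulr_gt0 => //.
have [t1 [t10 t11 t12 t13]] := small3 d0_gt0 b1 b2.
have [t2 [t20 t21 t22 t23]] := small3 t10 b3 b4.
exists k, q, e1, eps, t2; split=> //; lra.
Qed.

Variables (k q e1 eps de : R).
Hypothesis sc : shadow_scales k q e1 eps de.

Definition deep (s : R) x := forall y, nm (y - x) <= s -> W y.

(** The Lipschitz bound on [G - f] replaces closeness of derivatives, since the interpolated map is
    not assumed differentiable. *)
Record perturbation G : Prop := Perturbation {
  pert_close : forall x, nm (G x - f x) <= de;
  pert_lip : forall x y, nm ((G x - f x) - (G y - f y)) <= de * nm (x - y);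
  pert_out : forall x, ~ deep (eta / 4) x -> G x = f x }.

Lemma deep_le s t x : s <= t -> deep t x -> deep s x.
Proof. by move=> st h y hy; apply: h; lra. Qed.

Lemma deep_in s x : 0 <= s -> deep s x -> W x.
Proof. by move=> s0; apply; rewrite subrr nm0. Qed.

Lemma deep_shift s t x y : nm (y - x) <= t -> deep (s + t) x -> deep s y.
Proof.
move=> xy h z hz; apply: h; have := nm_triangle y z x; lra.
Qed.

Lemma pert_preimage G x : perturbation G -> W (G x) -> deep eta x.
Proof.
move=> hG Wx y; apply: (trap_inner tr Wx); rewrite nmB.
by apply: le_trans (pert_close hG x) _; exact: sc_ded0 sc.
Qed.

Lemma pert_notW G x : perturbation G -> ~ W x -> G x = f x /\ ~ W (G x).
Proof.
move=> hG nW; have eta_gt0 := trap_eta tr; split.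
- apply: (pert_out hG) => /deep_in h; apply: nW; apply: h; lra.
- by move=> /(pert_preimage hG)/deep_in h; apply: nW; apply: h; lra.
Qed.

Lemma pert_ccont G K : perturbation G -> ccont K G.
Proof.
move=> hG z Kz e e0; have de0 := sc_de sc.
pose L : R := 2 * nm z + 1 + de; have L0 : 0 < L by rewrite /L; have := nm_ge0 z; lra.
have [t [t0 t1 te]] := small2 ltr01 (divr_gt0 e0 L0); exists t => // y Ky yz.
have -> : G y - G z = (y - z) * (y + z) + ((G y - f y) - (G z - f z)).
  by rewrite /quad; ring.
apply: le_lt_trans (nmD _ _) _; rewrite nmM.
have h1 := pert_lip hG y z.
have h2 : nm (y + z) <= 2 * nm z + 1.
  have -> : y + z = (y - z) + 2 * z by ring.
  apply: le_trans (nmD _ _) _; rewrite nmM -(rc_nat 2) nm_rc ger0_norm//; lra.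
have h3 := ler_wpM2l (nm_ge0 (y - z)) h2.
have : nm (y - z) * L < e.
  by rewrite -ltr_pdivlMr//; lra.
rewrite /L; lra.
Qed.

Lemma pert_linear G x w w' : perturbation G -> eta0 <= nm x ->
  nm (w - x) <= e1 -> nm (w' - x) <= e1 ->
  nm (G w - G w' - 2 * x * (w - w')) <= q * nm (2 * x) * nm (w - w').
Proof.
move=> hG x0 wx w'x.
have -> : G w - G w' - 2 * x * (w - w') = (w - w') * ((w - x) + (w' - x)) +
  ((G w - f w) - (G w' - f w')) by rewrite /quad; ring.
apply: le_trans (nmD _ _) _; rewrite nmM.
have h1 := pert_lip hG w w'.
have h2 : nm (w - x + (w' - x)) <= 2 * e1 by apply: le_trans (nmD _ _) _; lra.
have h3 := ler_wpM2l (nm_ge0 (w - w')) h2.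
have h4 : 2 * e1 + de <= q * nm (2 * x).
  rewrite nmM -(rc_nat 2) nm_rc ger0_norm//.
  have := sc_e1q sc; have := sc_deq sc; have := ler_wpM2l (ltW (sc_q0 sc)) x0; lra.
have := ler_wpM2r (nm_ge0 (w - w')) h4; lra.
Qed.

Lemma pert_expand G x w w' : perturbation G -> eta0 <= nm x ->
  nm (w - x) <= e1 -> nm (w' - x) <= e1 ->
  (1 - q) * nm (2 * x) * nm (w - w') <= nm (G w - G w').
Proof.
move=> hG x0 wx w'x; have := pert_linear hG x0 wx w'x.
have := nmB_ge (2 * x * (w - w')) (2 * x * (w - w') - (G w - G w')).
rewrite subKr (nmB (2 * x * (w - w'))) (nmM (2 * x)); lra.
Qed.

(* A minimiser of [|y - G w|] is improved by a Newton step unless it is a solution. *)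
Lemma pert_solve G x y (r : R) : perturbation G -> eta0 <= nm x -> 0 <= r -> r <= e1 ->
  nm (y - G x) <= (1 - q) * nm (2 * x) * r -> exists2 w, nm (w - x) <= r & G w = y.
Proof.
move=> hG x0 r0 re1 hy.
have eta0_gt0 := trap_eta0 tr.
have q0 := sc_q0 sc; have q1 := sc_q1 sc.
have xx0 : 0 < nm (2 * x) by rewrite nmM -(rc_nat 2) nm_rc ger0_norm//; lra.
have xn0 : 2 * x != 0 by rewrite -nm_gt0.
pose K := [set w : Cplx R | nm (w - x) <= r].
have cK : ccont K (fun w => y - G w).
  move=> z Kz e e0; have [d dd h] := pert_ccont hG Kz e0; exists d => // z' Kz' hz.
  by rewrite opprB addrC addrA subrK nmB; exact: h.
have Kx : K x by rewrite /K /= subrr nm0.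
have [w Kw wmin] := rcont_min (@disc_compact R x r) (ccont_nm cK) (ex_intro _ x Kx).
exists w => //; apply/eqP; rewrite eq_sym -subr_eq0 -nm_eq0 eq_le nm_ge0 andbT.
pose w' := w + (y - G w) / (2 * x).
have wE : 2 * x * (w' - w) = y - G w.
  by rewrite /w' addrAC subrr add0r mulrC divfK.
have we : nm (w - x) <= e1 by apply: le_trans re1.
have xe : nm (x - x) <= e1 by rewrite subrr nm0 ltW// (sc_e1 sc).
(* The factor [1 - q] in the assumption on [y] leaves the share [q] for the error of linearisation,
   so the Newton step does not leave the disc. *)
have Kw' : K w'.
  rewrite /K /= -(@ler_pM2l _ (nm (2 * x)))// -nmM.
  have -> : 2 * x * (w' - x) = (y - G x) - (G w - G x - 2 * x * (w - x)).
    have -> : 2 * x * (w' - x) = 2 * x * (w' - w) + 2 * x * (w - x) by ring.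
    by rewrite wE; ring.
  apply: le_trans (nmD _ _) _; rewrite nmN.
  have := pert_linear hG x0 we xe.
  have : q * nm (2 * x) * nm (w - x) <= q * nm (2 * x) * r.
    by apply: ler_wpM2l => //; apply: mulr_ge0; lra.
  lra.
have w'e : nm (w' - x) <= e1 by apply: le_trans re1; exact: Kw'.
have h1 := wmin _ Kw'.
have h2 := pert_linear hG x0 w'e we.
have h3 : nm (y - G w') <= q * nm (y - G w).
  have -> : y - G w' = - (G w' - G w - 2 * x * (w' - w)) by rewrite wE; ring.
  by rewrite nmN; apply: le_trans h2 _; rewrite -mulrA -nmM wE.
have := ler_wpM2r (nm_ge0 (y - G w)) (ltW q1).
have := nm_ge0 (y - G w).
have h4 := le_trans h1 h3; have q2 : 0 < 1 - q by lra.
move=> _ _; rewrite -(@ler_pM2l _ (1 - q))// mulr0; lra.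
Qed.

Definition near_orbit x y : Prop :=
  if `[< W x >] then is_true (nm (y - x) <= eps * kap x) else y = x.

Lemma near_orbit_in x y : W x -> near_orbit x y <-> nm (y - x) <= eps * kap x.
Proof. by move=> h; rewrite /near_orbit asboolT. Qed.

Lemma near_orbit_out x y : ~ W x -> near_orbit x y <-> y = x.
Proof. by move=> h; rewrite /near_orbit asboolF. Qed.

Lemma near_orbit_e1 x y : near_orbit x y -> nm (y - x) <= e1.
Proof.
have e10 := sc_e1 sc; have e0 := sc_eps sc.
rewrite /near_orbit; case: asboolP => _ h; last by rewrite h subrr nm0 ltW.
apply: le_trans h _; apply: le_trans (sc_epsB sc); apply: ler_wpM2l; first exact: ltW.
exact: (kappa_le tr).
Qed.

(** Write [G x] as [f z] with [z] close to [x] and apply the contraction for [f], with the discs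
    recentred at [x]; replacing [nm (2 * z)] by [nm (2 * x)] costs the factor [1 - q]. *)
Lemma pert_kappa G x : perturbation G -> W x -> W (G x) ->
  eta / 2 <= kap x /\ (1 - q) * kap (G x) <= k * (nm (2 * x) * kap x).
Proof.
move=> hG Wx WGx; have x0 := trap_crit tr Wx.
have q0 := sc_q0 sc; have q1 := sc_q1 sc; have e10 := sc_e1 sc.
have eta0_gt0 := trap_eta0 tr; have de0 := sc_de sc.
have pf : perturbation f.
  by split=> [y|y z|//]; rewrite !subrr nm0 ?mulr_ge0 ?nm_ge0// ltW.
have n2x : nm (2 * x) = 2 * nm x by rewrite nmM -(rc_nat 2) nm_rc ger0_norm.
have [|z hz fz] := pert_solve (y := G x) pf x0 (ltW e10) (lexx _).
  apply: le_trans (pert_close hG x) _; apply: le_trans (sc_de1 sc) _.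
  apply: ler_wpM2r; first exact: ltW.
  by apply: ler_wpM2l; lra.
have e1e := sc_e1eta sc; have eta_gt0 := trap_eta tr.
have [|h1 h2] := kappa_contract tr (x := x) fz WGx; first by rewrite nmB; lra.
split=> //.
have h3 : (1 - q) * nm (2 * z) <= nm (2 * x).
  have -> : nm (2 * z) = 2 * nm z by rewrite nmM -(rc_nat 2) nm_rc ger0_norm.
  have hzx := nmB_ge z x; rewrite n2x.
  have hq := sc_e1q sc.
  have h4 : q * eta0 <= q * nm x by apply: ler_wpM2l; lra.
  have h5 : nm z <= (1 + q) * nm x by lra.
  have h6 := ler_wpM2l (ltW (_ : 0 < 1 - q)) h5.
  have {}h6 : (1 - q) * nm z <= (1 - q) * ((1 + q) * nm x) by apply: h6; lra.
  have := mulr_ge0 (sqr_ge0 q) (nm_ge0 x); rewrite expr2; lra.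
have kx0 : 0 <= kap x by lra.
have h4 := ler_wpM2r kx0 h3.
have h5 : 0 <= nm (2 * z) * kap x by rewrite mulr_ge0 ?nm_ge0.
have h6 := ler_wpM2r h5 (sc_rate sc).
have q2 : 0 <= 1 - q by lra.
have h7 := ler_wpM2l q2 (le_trans h2 h6).
have := ler_wpM2l (ltW (sc_k0 sc)) h4; lra.
Qed.

(** The tube pulls back into itself. While the orbit stays in [W], expansion leaves room for the
    error [2 * de]. When it leaves, either [x] is deep, so that the tube about it is wide enough for
    the error, or both maps agree with [f] at [x] and [y = x] works. *)
Lemma shadow_step G1 G2 x y1 : perturbation G1 -> perturbation G2 ->
  near_orbit (G1 x) y1 -> exists2 y, near_orbit x y & G2 y = y1.
Proof.
move=> h1 h2 hy1.
have [Wx|nWx] := pselect (W x); last first.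
  have [g1 nW1] := pert_notW h1 nWx; have [g2 _] := pert_notW h2 nWx.
  by exists x; [exact/near_orbit_out|]; move: hy1 => /(near_orbit_out _ nW1) ->; rewrite g2 g1.
have q0 := sc_q0 sc; have q1 := sc_q1 sc; have e10 := sc_e1 sc; have eps0 := sc_eps sc.
have eta0_gt0 := trap_eta0 tr; have de0 := sc_de sc; have eta_gt0 := trap_eta tr.
have x0 := trap_crit tr Wx.
have n2x : nm (2 * x) = 2 * nm x by rewrite nmM -(rc_nat 2) nm_rc ger0_norm.
have dG : nm (G1 x - G2 x) <= 2 * de.
  have := nm_triangle (f x) (G1 x) (G2 x); have := pert_close h1 x; have := pert_close h2 x.
  by rewrite (nmB (f x)); lra.
have solve : forall s, 0 <= s -> s <= kap x ->
    nm (y1 - G2 x) <= (1 - q) * nm (2 * x) * (eps * s) ->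
    exists2 y, near_orbit x y & G2 y = y1.
  move=> s s0 sk hs; have [||y hy <-] := pert_solve h2 x0 _ _ hs.
  - by rewrite mulr_ge0// ltW.
  - apply: le_trans (sc_epsB sc); apply: ler_wpM2l; first exact: ltW.
    by apply: le_trans sk _; exact: (kappa_le tr).
  exists y => //; apply/(near_orbit_in _ Wx); apply: le_trans hy _.
  by apply: ler_wpM2l => //; exact: ltW.
have [W1|nW1] := pselect (W (G1 x)); last first.
  move: hy1 => /(near_orbit_out _ nW1) y1E.
  have [dx|ndx] := pselect (deep (eta / 4) x).
    have e4 : 0 <= eta / 4 by lra.
    apply: (solve (eta / 4) e4); first exact: (kappa_ge_radius tr e4 dx).
    rewrite y1E; apply: le_trans dG _; apply: le_trans (sc_de2 sc) _.
    apply: ler_wpM2r; first by apply: mulr_ge0; lra.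
    by apply: ler_wpM2l; lra.
  exists x; last by rewrite y1E (pert_out h1 ndx) (pert_out h2 ndx).
  apply/(near_orbit_in _ Wx); rewrite subrr nm0; apply: mulr_ge0; first exact: ltW.
  exact/(kappa_ge tr)/(disc_slopes0 Wx).
have [kx kc] := pert_kappa h1 Wx W1.
move: hy1 => /(near_orbit_in _ W1) hy1.
have kx0 : 0 <= kap x by lra.
apply: (solve (kap x)) => //.
have h3 : nm (y1 - G2 x) <= eps * kap (G1 x) + 2 * de.
  by have := nm_triangle (G1 x) y1 (G2 x); lra.
apply: le_trans h3 _.
have g : 0 <= (1 - q) - k / (1 - q).
  rewrite subr_ge0 ler_pdivrMr -?expr2; last lra.
  by rewrite ltW// (sc_kq sc).
have h4 : kap (G1 x) <= k / (1 - q) * (nm (2 * x) * kap x).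
  rewrite -(@ler_pM2l _ (1 - q)); last lra.
  have kE : (1 - q) * (k / (1 - q)) = k by rewrite mulrC divfK// gt_eqF//; lra.
  by rewrite [X in _ <= X]mulrA kE.
have h5 := ler_wpM2l (ltW eps0) h4.
have h6 : eta * eta0 <= nm (2 * x) * kap x.
  have -> : eta * eta0 = (2 * eta0) * (eta / 2) by field.
  by apply: ler_pM; rewrite ?n2x; lra.
have h7 : eps * (eta * eta0) * (1 - q - k / (1 - q)) <= eps * (nm (2 * x) * kap x) * (1 - q - k / (1 - q)).
  by apply: ler_wpM2r => //; apply: ler_wpM2l => //; exact: ltW.
have := sc_de3 sc; move: h5 h7.
move: (k / (1 - q)) => K h5 h7 h8; lra.
Qed.

Lemma finite_shadow G1 G2 n x : perturbation G1 -> perturbation G2 ->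
  exists y, forall i, (i <= n)%N -> near_orbit (iter i G1 x) (iter i G2 y).
Proof.
move=> h1 h2; elim: n x => [|n IH] x.
  exists x => i; rewrite leqn0 => /eqP-> /=.
  have [Wx|nWx] := pselect (W x); last exact/near_orbit_out.
  apply/(near_orbit_in _ Wx); rewrite subrr nm0; apply: mulr_ge0.
    by have := sc_eps sc; lra.
  exact/(kappa_ge tr)/(disc_slopes0 Wx).
have [y1 hy1] := IH (G1 x).
have [y hy yE] := shadow_step h1 h2 (hy1 0%N isT).
by exists y => -[|i] // iN; rewrite !iterSr yE; exact: hy1.
Qed.

(** The tube width [eps * kap x] is weakened to the uniform bound [e1], which passes to limits
    without continuity of [kap]. *)
Definition shadow G1 G2 x y := forall n, nm (iter n G2 y - iter n G1 x) <= e1 /\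
  (~ W (iter n G1 x) -> iter n G2 y = iter n G1 x).

Lemma shadow_shift G1 G2 x y : shadow G1 G2 x y -> shadow G1 G2 (G1 x) (G2 y).
Proof. by move=> h n; rewrite -!iterSr. Qed.

Lemma iter_ccont G n : perturbation G -> ccont setT (iter n G).
Proof.
move=> hG; elim: n => [|n IH]; first exact: ccont_id.
move=> z _ e e0; have [d d0' h] := pert_ccont (K := setT) hG (I : setT (iter n G z)) e0.
have [t t0 ht] := IH z I d d0'; exists t => // y _ hy; exact/h/ht.
Qed.

Lemma shadow_limit G1 G2 x (u v : nat -> Cplx R) l : perturbation G1 -> perturbation G2 ->
  (forall e : R, 0 < e -> forall N, exists2 n, (N <= n)%N & nm (v n - l) < e /\ nm (u n - x) < e) ->
  (forall i, exists N, forall n, (N <= n)%N -> nm (iter i G2 (v n) - iter i G1 (u n)) <= e1) ->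
  forall i, nm (iter i G2 l - iter i G1 x) <= e1.
Proof.
move=> h1 h2 cl hs i; apply/ler_addgt0Pr => e e0.
have e2 : 0 < e / 2 by lra.
have [d d0' hd] := iter_ccont i h2 (I : setT l) e2.
have [t t0 ht] := iter_ccont i h1 (I : setT x) e2.
have [s [s0 sd st]] := small2 d0' t0.
have [N hN] := hs i; have [n Nn [hv hu]] := cl s s0 N.
have := hN n Nn; have := hd (v n) I (lt_le_trans hv sd); have := ht (u n) I (lt_le_trans hu st).
have := nm_triangle (iter i G2 (v n)) (iter i G2 l) (iter i G1 x).
have := nm_triangle (iter i G1 (u n)) (iter i G2 (v n)) (iter i G1 x).
rewrite (nmB (iter i G2 l) (iter i G2 (v n))); lra.
Qed.

Lemma shadow_exists G1 G2 x : perturbation G1 -> perturbation G2 ->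
  exists y, shadow G1 G2 x y.
Proof.
move=> h1 h2.
have /choice[v hv] n := finite_shadow n x h1 h2.
have vb n : nm (v n) <= nm x + e1.
  have := near_orbit_e1 (hv n 0%N isT); have := nmB_ge (v n) x; rewrite /=; lra.
have [l hl] := bolzano_weierstrass vb; exists l => i; split.
  apply: (@shadow_limit G1 G2 x (fun=> x) v l) => //.
  - move=> e e0 N; have [n Nn hn] := hl e e0 N; exists n => //.
    by rewrite subrr nm0.
  - by move=> j; exists j => n jn; apply: near_orbit_e1; exact: hv.
move=> nW; apply: nm_le_eq => e e0.
have [d d0' hd] := iter_ccont i h2 (I : setT l) e0.
have [n jn /(hd _ I)] := hl d d0' i.
by move: (hv n i jn) => /(near_orbit_out _ nW) ->; rewrite nmB => /ltW.
Qed.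

Lemma nm_2 x : nm (2 * x) = 2 * nm x.
Proof. by rewrite nmM -(rc_nat 2) nm_rc ger0_norm. Qed.

Lemma shadow_out G1 G2 x y : shadow G1 G2 x y -> ~ W x -> y = x.
Proof. by move=> /(_ 0%N)[_]; exact. Qed.

Lemma shadow_collapse G1 G2 x y y' : perturbation G1 -> perturbation G2 ->
  shadow G1 G2 x y -> shadow G1 G2 x y' -> W x -> G2 y = G2 y' -> y = y'.
Proof.
move=> h1 h2 hy hy' Wx e; have x0 := trap_crit tr Wx.
have := pert_expand h2 x0 (hy 0%N).1 (hy' 0%N).1; rewrite /= e subrr nm0 => h.
have q1 := sc_q1 sc; have eta0_gt0 := trap_eta0 tr.
have c0' : 0 < (1 - q) * nm (2 * x) by apply: mulr_gt0; rewrite ?nm_2; lra.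
apply/eqP; rewrite -subr_eq0 -nm_eq0 eq_le nm_ge0 andbT.
by rewrite -(@ler_pM2l _ ((1 - q) * nm (2 * x)))// mulr0.
Qed.

Lemma shadow_exit G1 G2 x y y' : perturbation G1 -> perturbation G2 ->
  shadow G1 G2 x y -> shadow G1 G2 x y' -> ~ W (G1 x) -> y = y'.
Proof.
move=> h1 h2 hy hy' nW.
have [Wx|nWx] := pselect (W x); last by rewrite (shadow_out hy nWx) (shadow_out hy' nWx).
apply: (shadow_collapse h1 h2 hy hy' Wx).
by have /= -> := (hy 1%N).2 nW; have /= -> := (hy' 1%N).2 nW.
Qed.

(** Expansion over [n] steps shrinks the initial gap geometrically. If the orbit leaves [W] in the
    meantime, the two shadows agree at the exit, and local injectivity carries the equality back. *)
Lemma shadow_unique G1 G2 x y y' : perturbation G1 -> perturbation G2 ->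
  shadow G1 G2 x y -> shadow G1 G2 x y' -> y = y'.
Proof.
move=> h1 h2; have q1 := sc_q1 sc; have q0 := sc_q0 sc; have k0 := sc_k0 sc.
have e10 := sc_e1 sc; have eta_gt0 := trap_eta tr; have eta0_gt0 := trap_eta0 tr.
have q2 : 0 < 1 - q by lra.
have q22 : 0 < (1 - q) ^+ 2 by exact: exprn_gt0.
(* One factor [1 - q] is lost in the expansion of [G2] and one in the contraction of [kap]; [C] is
   set so that the trivial bound [2 * e1] equals [C * (eta / 2)], hence is at most [C * kap x]. *)
pose s := k / (1 - q) ^+ 2; pose C := 4 * e1 / eta.
have sE : s * (1 - q) ^+ 2 = k by rewrite divfK// gt_eqF.
have CE : C * eta = 4 * e1 by rewrite divfK// gt_eqF.
have s0 : 0 <= s by apply: divr_ge0; exact: ltW.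
have s1 : s < 1 by rewrite ltr_pdivrMr// mul1r (sc_kq sc).
have C0 : 0 < C by apply: divr_gt0; lra.
clearbody s C.
have key n : forall x y y', shadow G1 G2 x y -> shadow G1 G2 x y' ->
    y = y' \/ nm (y - y') <= C * s ^+ n * kap x.
  elim: n => [|n IH] {}x {}y {}y' hy hy'.
  - have [W1|nW1] := pselect (W (G1 x)); last by left; exact: shadow_exit hy hy' nW1.
    have [Wx|nWx] := pselect (W x); last first.
      by left; rewrite (shadow_out hy nWx) (shadow_out hy' nWx).
    right; have [kx _] := pert_kappa h1 Wx W1.
    rewrite expr0 mulr1; have := nm_triangle x y y'.
    have /= [a1 _] := hy 0%N; have /= [a2 _] := hy' 0%N; rewrite (nmB x y').
    by have := ler_wpM2l (ltW C0) kx; lra.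
  - have [W1|nW1] := pselect (W (G1 x)); last by left; exact: shadow_exit hy hy' nW1.
    have [Wx|nWx] := pselect (W x); last first.
      by left; rewrite (shadow_out hy nWx) (shadow_out hy' nWx).
    have [e|h] := IH _ _ _ (shadow_shift hy) (shadow_shift hy').
      by left; exact: (shadow_collapse h1 h2 hy hy' Wx).
    right; have [kx kc] := pert_kappa h1 Wx W1; have x0 := trap_crit tr Wx.
    have h3 := pert_expand h2 x0 (hy 0%N).1 (hy' 0%N).1; rewrite /= in h3.
    have h4 := ler_wpM2l (ltW q2) (le_trans h3 h).
    have Cs : 0 <= C * s ^+ n by rewrite mulr_ge0 ?exprn_ge0// ltW.
    have h5 := ler_wpM2l Cs kc.
    have x2 : 0 < nm (2 * x) by rewrite nm_2; lra.
    rewrite -(@ler_pM2l _ ((1 - q) ^+ 2 * nm (2 * x))); last exact: mulr_gt0.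
    have -> : (1 - q) ^+ 2 * nm (2 * x) * (C * s ^+ n.+1 * kap x)
        = C * s ^+ n * (s * (1 - q) ^+ 2) * (nm (2 * x) * kap x).
      by rewrite [s ^+ n.+1]exprS; ring.
    by rewrite sE expr2; lra.
move=> hy hy'; apply: nm_le_eq => e e0.
have B0 := trap_B tr.
have CB : 0 < C * (2 * B) by apply: mulr_gt0; lra.
have [n hn] := geometric_small s0 s1 (divr_gt0 e0 CB).
have [->|h] := key n _ _ _ hy hy'; first by rewrite subrr nm0 ltW.
move: hn; rewrite ltr_pdivlMr// => hn; apply: le_trans h _.
have Cs : 0 <= C * s ^+ n by rewrite mulr_ge0 ?exprn_ge0// ltW.
by have := ler_wpM2l Cs (kappa_le tr x); lra.
Qed.

(** Near the boundary of [W] the next point is already outside, so [x] and [y] have the same image,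
    under [f] at both; thus [y] is [x] or [- x], and the latter is too far away. Equality thus
    extends past the complement of [W], which gives symmetry and continuity of shadowing. *)
Lemma shadow_near_out G1 G2 x y : perturbation G1 -> perturbation G2 ->
  shadow G1 G2 x y -> ~ deep (eta / 8) x -> y = x.
Proof.
move=> h1 h2 hy nd; have eta_gt0 := trap_eta tr.
have [Wx|nWx] := pselect (W x); last exact: shadow_out hy nWx.
have nW1 : ~ W (G1 x).
  by move=> /(pert_preimage h1) /(@deep_le (eta / 8)) h; apply: nd; apply: h; lra.
have nd4 : ~ deep (eta / 4) x.
  by move=> /(@deep_le (eta / 8)) h; apply: nd; apply: h; lra.
have [yx _] := hy 0%N; rewrite /= in yx.
have e1e := sc_e1eta sc; have e10 := sc_e1 sc.
have nd' : ~ deep (eta / 4) y.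
  move=> h; apply: nd; apply: (@deep_shift _ (eta / 8) y); first by rewrite nmB; lra.
  by have -> : eta / 8 + eta / 8 = eta / 4 by field.
have /= := (hy 1%N).2 nW1; rewrite (pert_out h2 nd') (pert_out h1 nd4) /quad => /addIr /eqP.
rewrite eqf_sqr => /orP[/eqP//|/eqP yE].
have := trap_crit tr Wx; have := sc_e1q sc; have := sc_q1 sc; have := trap_eta0 tr.
have xx : - x - x = - (2 * x) by ring.
move: yx; rewrite yE xx nmN nm_2 => h5 h6 h7 h8 h9.
by exfalso; have := ler_wpM2r (ltW h6) (ltW h7); lra.
Qed.

Lemma shadow_sym G1 G2 x y : perturbation G1 -> perturbation G2 ->
  shadow G1 G2 x y -> shadow G2 G1 y x.
Proof.
move=> h1 h2 hy n; have [hn1 hn2] := hy n; split; first by rewrite nmB.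
move=> nW; have sn : shadow G1 G2 (iter n G1 x) (iter n G2 y).
  by move=> m; rewrite -!iterD; exact: hy.
apply/esym/(shadow_near_out h1 h2 sn) => h; apply: nW; apply: h.
by apply: le_trans hn1 (sc_e1eta sc).
Qed.

(** A closed graph argument: values of [h] along a sequence tending to [x] are bounded, any cluster
    point shadows [x], and the shadow is unique. *)
Lemma shadow_continuous G1 G2 h : perturbation G1 -> perturbation G2 ->
  (forall x, shadow G1 G2 x (h x)) -> ccont setT h.
Proof.
move=> h1 h2 hs x _ e e0; apply: contrapT => nh.
have /choice[u hu] n : exists y, nm (y - x) < epsn n /\ e <= nm (h y - h x).
  apply: contrapT => nh'; apply: nh; exists (epsn n); first exact: epsn_gt0.
  by move=> y _ yx; rewrite ltNge; apply/negP => hy; apply: nh'; exists y.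
have e10 := sc_e1 sc.
have hb n : nm (h (u n)) <= nm x + 1 + e1.
  have /= [a _] := hs (u n) 0%N; have [b _] := hu n.
  have := nmB_ge (h (u n)) (u n); have := nmB_ge (u n) x.
  have : epsn n <= 1 :> R by rewrite /epsn invf_le1 ?ler1n.
  lra.
have [l hl] := bolzano_weierstrass hb.
have cl : forall e : R, 0 < e -> forall N, exists2 n, (N <= n)%N &
    nm (h (u n) - l) < e /\ nm (u n - x) < e.
  move=> s s0 N; have [M hM] := epsn_small s0.
  have [n hn hln] := hl s s0 (maxn N M); exists n; first by apply: leq_trans hn; exact: leq_maxl.
  by split=> //; apply: lt_trans (hu n).1 _; apply: hM; apply: leq_trans hn; exact: leq_maxr.
have sl : shadow G1 G2 x l.
  move=> i; split.
    apply: (shadow_limit h1 h2 cl) => j; exists 0%N => n _; exact: (hs (u n) j).1.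
  move=> nW; apply: nm_le_eq => s s0.
  have s2 : 0 < s / 2 by lra.
  have e8 : 0 < eta / 8 by have := trap_eta tr; lra.
  have [d1 d10 hd1] := iter_ccont i h2 (I : setT l) s2.
  have [t [t0 ts te]] := small2 s2 e8.
  have [d2 d20 hd2] := iter_ccont i h1 (I : setT x) t0.
  have [d [d0' dd1 dd2]] := small2 d10 d20.
  have [n _ [a b]] := cl d d0' 0%N.
  have {}hd1 := hd1 _ I (lt_le_trans a dd1); have {}hd2 := hd2 _ I (lt_le_trans b dd2).
  have sn : shadow G1 G2 (iter i G1 (u n)) (iter i G2 (h (u n))).
    by move=> m; rewrite -!iterD; exact: hs.
  have := shadow_near_out h1 h2 sn => E.
  have {}E : iter i G2 (h (u n)) = iter i G1 (u n).
    by apply: E => D; apply: nW; apply: D; rewrite nmB; lra.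
  have := nm_triangle (iter i G2 (h (u n))) (iter i G2 l) (iter i G1 x).
  rewrite (nmB (iter i G2 l) (iter i G2 (h (u n)))); rewrite E in hd1 *; lra.
have lE : l = h x by exact: (shadow_unique h1 h2 sl (hs x)).
have [n _ [a _]] := cl e e0 0%N.
by have := (hu n).2; rewrite -lE; lra.
Qed.

Lemma perturbation_conjugacy G1 G2 : perturbation G1 -> perturbation G2 ->
  exists h h' : Cplx R -> Cplx R, [/\ cancel h h', cancel h' h,
    ccont setT h, ccont setT h' & forall x,
    [/\ nm (h x - x) <= e1, nm (h' x - x) <= e1, h (G1 x) = G2 (h x),
        h' (G2 x) = G1 (h' x) & (W (h x) <-> W x) /\ (W (h' x) <-> W x)]].
Proof.
move=> h1 h2.
have /choice[h hs] x := shadow_exists x h1 h2.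
have /choice[h' hs'] x := shadow_exists x h2 h1.
have W12 F1 F2 x y : perturbation F1 -> perturbation F2 -> shadow F1 F2 x y -> W y <-> W x.
  move=> p1 p2 sxy; split=> Wz; apply: contrapT => nW.
    by apply: (nW); rewrite -(shadow_out sxy nW).
  by apply: (nW); rewrite -(shadow_out (shadow_sym p1 p2 sxy) nW).
exists h, h'; split.
- by move=> x; apply: (shadow_unique h2 h1 (hs' (h x))); exact: shadow_sym.
- by move=> x; apply: (shadow_unique h1 h2 (hs (h' x))); exact: shadow_sym.
- exact: shadow_continuous hs.
- exact: shadow_continuous hs'.
- move=> x; split.
  + exact: (hs x 0%N).1.
  + exact: (hs' x 0%N).1.
  + by apply: (shadow_unique h1 h2 (hs (G1 x))); exact/shadow_shift.
  + by apply: (shadow_unique h2 h1 (hs' (G2 x))); exact/shadow_shift.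
  + by split; [exact: (W12 G1 G2)|exact: (W12 G2 G1)].
Qed.

End shadowing.

(** * Interpolation between two quadratic maps *)

Section interpolation.
Context {R : realType}.
Implicit Types (c x y z w : Cplx R).

Definition clamp (a : R) : R := if a <= 0 then 0 else if 1 <= a then 1 else a.

Lemma clamp_lip a b : `|clamp a - clamp b| <= `|a - b|.
Proof.
have h (s t : R) : 0 <= t - s -> (t - s <= b - a) || (t - s <= a - b) -> `|t - s| <= `|a - b|.
  move=> ts /orP[] h; rewrite (ger0_norm ts).
    by apply: le_trans h _; rewrite distrC ler_norm.
  by apply: le_trans h _; rewrite ler_norm.
rewrite /clamp; case: (lerP a 0) => ha; case: (lerP b 0) => hb;
  try case: (lerP 1 a) => ha'; try case: (lerP 1 b) => hb';
  first [by rewrite subrr normr0 | by apply: h; lra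
        | by rewrite distrC; apply: h; lra | by []].
Qed.

Lemma clamp_itv a : 0 <= clamp a /\ clamp a <= 1.
Proof.
by rewrite /clamp; case: (lerP a 0) => ha; [|case: (lerP 1 a) => ha']; split; lra.
Qed.

Variables (c0 : Cplx R) (W : set (Cplx R)) (B eta eta0 d0 : R).
Hypothesis tr : trap c0 W B eta eta0 d0.

Definition margin x : R := inf [set nm (y - x) | y in ~` W].

Lemma margin_set x : has_inf [set nm (y - x) | y in ~` W].
Proof.
split; last by exists 0 => _ [y _ <-]; exact: nm_ge0.
exists (nm (0 - x)), 0 => //= /(trap_crit tr); rewrite nm0.
by have := trap_eta0 tr; lra.
Qed.

Lemma margin_ge s x : deep W s x -> s <= margin x.
Proof.
move=> ds; apply: lb_le_inf; first exact: (margin_set x).1.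
move=> _ [y nW <-]; rewrite leNgt; apply/negP => h; apply: nW; apply: ds; exact: ltW.
Qed.

Lemma margin_deep s x : s < margin x -> deep W s x.
Proof.
move=> h y ys; apply: contrapT => nW; have : margin x <= nm (y - x).
  by apply: ge_inf; [exact: (margin_set x).2 | exists y].
by lra.
Qed.

Lemma margin_lip1 x y : margin x - margin y <= nm (x - y).
Proof.
rewrite lerBlDr addrC -lerBlDr; apply: lb_le_inf; first exact: (margin_set y).1.
move=> _ [z nW <-].
have : margin x <= nm (z - x) by apply: ge_inf; [exact: (margin_set x).2 | exists z].
by have := nm_triangle y z x; rewrite (nmB y x); lra.
Qed.

Lemma margin_lip x y : `|margin x - margin y| <= nm (x - y).
Proof.
rewrite ler_norml margin_lip1 andbT lerNl opprB nmB; exact: margin_lip1.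
Qed.

(* 0 on points of margin at most [eta / 4], 1 on points of margin at least [eta / 2]. *)
Definition cutoff x : R := clamp ((margin x - eta / 4) / (eta / 4)).

Definition interpolate c1 x : Cplx R := quad c0 x + rc (cutoff x) * (c1 - c0).

Lemma cutoff_lip x y : `|cutoff x - cutoff y| <= 4 / eta * nm (x - y).
Proof.
have eta_gt0 := trap_eta tr.
apply: le_trans (clamp_lip _ _) _.
have -> : (margin x - eta / 4) / (eta / 4) - (margin y - eta / 4) / (eta / 4)
  = 4 / eta * (margin x - margin y) by field; rewrite gt_eqF.
rewrite normrM ger0_norm; last by apply: divr_ge0; lra.
by apply: ler_wpM2l; [apply: divr_ge0; lra | exact: margin_lip].
Qed.

Lemma interpolate_pert (de : R) c1 : 0 <= de -> nm (c1 - c0) <= de ->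
  nm (c1 - c0) * (4 / eta) <= de -> perturbation c0 W eta de (interpolate c1).
Proof.
move=> de0 h1 h2; have eta_gt0 := trap_eta tr.
have E x : interpolate c1 x - quad c0 x = rc (cutoff x) * (c1 - c0).
  by rewrite /interpolate addrC addKr.
split.
- move=> x; rewrite E nmM nm_rc; have [a b] := clamp_itv ((margin x - eta / 4) / (eta / 4)).
  rewrite ger0_norm// -/(cutoff x); apply: le_trans h1.
  by rewrite ler_piMl// nm_ge0.
- move=> x y; rewrite !E -mulrBl -rcN -rcD nmM nm_rc.
  have := ler_wpM2r (nm_ge0 (c1 - c0)) (cutoff_lip x y).
  by have := ler_wpM2r (nm_ge0 (x - y)) h2; lra.
- move=> x nd; rewrite /interpolate /cutoff.
  have h : margin x <= eta / 4 by rewrite leNgt; apply/negP => /margin_deep.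
  have -> : clamp ((margin x - eta / 4) / (eta / 4)) = 0.
    rewrite /clamp ifT// pmulr_lle0; first lra.
    by rewrite invr_gt0; lra.
  by rewrite rc0 mul0r addr0.
Qed.

Lemma interpolate_deep c1 x : deep W (eta / 2) x -> interpolate c1 x = quad c1 x.
Proof.
move=> /margin_ge h; have eta_gt0 := trap_eta tr.
rewrite /interpolate /cutoff /clamp ifF; last first.
  by apply/negbTE; rewrite -ltNge; apply: divr_gt0; lra.
rewrite ifT; last by rewrite ler_pdivlMr; lra.
by rewrite rc1 mul1r /quad; ring.
Qed.

(** The equations are restricted to images in [W]: such points lie at depth [eta], so after a
    displacement of at most [eta / 8] they are still at depth [eta / 2], where the interpolated map
    is [quad c1]. *)
Lemma trap_stable : exists2 de : R, 0 < de & forall c1, nm (c1 - c0) <= de ->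
  nm (c1 - c0) <= d0 /\ exists h h' : Cplx R -> Cplx R, [/\ cancel h h', cancel h' h,
    ccont setT h, ccont setT h' & forall x,
    [/\ W (h x) <-> W x, W (h' x) <-> W x,
        W (quad c0 x) -> quad c1 (h x) = h (quad c0 x) &
        W (quad c1 x) -> quad c0 (h' x) = h' (quad c1 x)]].
Proof.
have [k [q [e1 [eps [de sc]]]]] := shadow_scales_exist tr.
have eta_gt0 := trap_eta tr; have de0 := sc_de sc.
have eta4 : 0 < de * (eta / 4) by apply: mulr_gt0; lra.
have [t [t0 t1 t2]] := small2 de0 eta4; exists t => // c1 hc1.
have hd0 : nm (c1 - c0) <= d0 by have := sc_ded0 sc; lra.
split=> //.
have p1 : perturbation c0 W eta de (quad c0).
  by split=> [y|y z|//]; rewrite !subrr nm0 ?mulr_ge0 ?nm_ge0// ltW.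
have p2 : perturbation c0 W eta de (interpolate c1).
  apply: interpolate_pert; [lra|lra|].
  have := ler_wpM2r (ltW (divr_gt0 (ltr0Sn R 3) eta_gt0)) (le_trans hc1 t2).
  have -> : de * (eta / 4) * (4 / eta) = de by field; rewrite gt_eqF.
  lra.
have [h [h' [k1 k2 k3 k4 k5]]] := perturbation_conjugacy tr sc p1 p2.
exists h, h'; split=> // x; have [l1 l2 l3 l4 [l5 l6]] := k5 x; split=> //.
- move=> Wx; rewrite l3 interpolate_deep//.
  have dx := pert_preimage tr sc p1 Wx.
  apply: (@deep_shift _ W (eta / 2) (eta / 8) x).
    by apply: le_trans l1 (sc_e1eta sc).
  by apply: deep_le dx; lra.
- move=> Wx; rewrite -l4 interpolate_deep//.
  move=> y hy; apply: (trap_inner tr Wx (x := x)); last by lra.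
  have -> : quad c0 x - quad c1 x = - (c1 - c0) by rewrite /quad; ring.
  by rewrite nmN.
Qed.

End interpolation.

(** * Transport of backward orbits between natural extensions *)

Section natural_extensions.
Context {R : realType}.
Local Notation C := (Cplx R).
Local Notation S := (sphere R).
Local Notation X := {ptws nat -> sphere R}.
Implicit Types (c z w : C) (W : set C) (zh : X) (h : C -> C).

Lemma ptws_cvg (F : set_system X) zh : Filter F ->
  (forall k, (fun yh : X => yh k) @ F --> zh k) -> F --> zh.
Proof.
move=> FF hF; apply/cvg_sup => i U [B [[V oV <-] Bz] BU].
apply: filterS BU _; apply: (hF i); exact: open_nbhs_nbhs.
Qed.

Lemma ptws_proj k : continuous (fun zh : X => zh k).
Proof. exact: (@proj_continuous _ (fun=> S) k). Qed.

Lemma ccont_continuous h : ccont setT h -> continuous h.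
Proof.
move=> ch z U /nbhs_nm[e e0 hU]; apply/nbhs_nm.
by have [d d0 hd] := ch z I e e0; exists d => // y yz; apply: hU; exact: hd.
Qed.

Lemma quad_continuous c : continuous (quad c).
Proof.
apply: ccont_continuous => z _ e e0.
have B0 : 0 < 2 * (nm z + 1) by have := nm_ge0 z; lra.
have [t [t0 t1 te]] := small2 ltr01 (divr_gt0 e0 B0); exists t => // y _ yz.
have zB : nm z <= nm z + 1 by lra.
have yB : nm y <= nm z + 1 by have := nmB_ge y z; lra.
apply: le_lt_trans (quad_lip c c zB yB) _; rewrite subrr nm0 addr0 mulrC.
by rewrite -ltr_pdivlMr//; lra.
Qed.

Lemma iter_continuous (T : topologicalType) (g : T -> T) n :
  continuous g -> continuous (iter n g).
Proof.
move=> cg; elim: n => [|n IH] z; first exact: cvg_id.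
by apply: (@continuous_comp _ _ _ (iter n g) g); [exact: IH|exact: cg].
Qed.

Lemma omap_continuous h z : {for z, continuous h} ->
  {for (Some z : S), continuous (omap h : S -> S)}.
Proof. by move=> ch U hU; exact: (ch (Some @^-1` U) hU). Qed.

Lemma quad_sphereE c : quad_sphere c = omap (quad c) :> (S -> S).
Proof. by apply/funext => -[]. Qed.

Lemma iter_omap h n (x : S) : iter n (omap h) x = omap (iter n h) x :> S.
Proof. by elim: n x => [|n IH] [x|] //=; rewrite IH. Qed.

Lemma iter_quad_sphere c n (x : S) :
  iter n (quad_sphere c) x = omap (iter n (quad c)) x :> S.
Proof. by rewrite quad_sphereE iter_omap. Qed.

Definition eventually_in c W : set X :=
  [set zh | natural_extension c zh /\ exists n, (Some @` W) (zh n)].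

Definition backward_invariant c W := forall z, W (quad c z) -> W z.

Lemma natural_extension_tail c W zh n m : backward_invariant c W ->
  natural_extension c zh -> (n <= m)%N -> (Some @` W) (zh n) -> (Some @` W) (zh m).
Proof.
move=> inv ext /subnKC <- hn; elim: (m - n)%N => [|d [z Wz zE]]; first by rewrite addn0.
rewrite addnS; move: (ext (n + d)%N); rewrite -zE; case: (zh _) => [w|//] [wz].
by exists w => //; apply: inv; rewrite wz.
Qed.

Lemma natural_extension_iter c zh k m : natural_extension c zh ->
  iter m (quad_sphere c) (zh (k + m)%N) = zh k.
Proof.
by move=> ext; elim: m => [|m IH]; rewrite ?addn0// iterSr addnS ext.
Qed.

(** An arbitrary choice of index; [push] turns out not to depend on it. The default 0 matters only
    for orbits that never meet [W]. *)
Definition level W zh : nat := xget 0%N [set n | (Some @` W) (zh n)].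

(* Conjugate far back along the orbit, where everything lies in [W], then iterate forward. *)
Definition push c h W zh : X :=
  fun k => omap (iter (level W zh) (quad c) \o h) (zh (k + level W zh)%N).

Section push.
Variables (c1 c2 : C) (W : set C) (h : C -> C).
Hypothesis inv1 : backward_invariant c1 W.
Hypothesis hW : forall z, W z -> W (h z).
Hypothesis equiv : forall z, W (quad c1 z) -> quad c2 (h z) = h (quad c1 z).

(** From index [k] on all coordinates lie in [W], so the conjugacy equation applies at each step and
    the forward iterates telescope. *)
Lemma push_tail zh k m : natural_extension c1 zh -> (Some @` W) (zh k) ->
  omap (iter m (quad c2) \o h) (zh (k + m)%N) = omap h (zh k) :> S.
Proof.
move=> ext hk; elim: m => [|m IH]; first by rewrite addn0.
have [z Wz zE] := natural_extension_tail inv1 ext (leq_addr m k) hk.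
rewrite -IH addnS -zE; move: (ext (k + m)%N); rewrite -zE; case: (zh _) => [w|//] [wz] /=.
by rewrite -iterS iterSr equiv wz.
Qed.

Lemma push_stable zh k n m : natural_extension c1 zh -> (Some @` W) (zh n) -> (n <= m)%N ->
  omap (iter m (quad c2) \o h) (zh (k + m)%N) =
  omap (iter n (quad c2) \o h) (zh (k + n)%N) :> S.
Proof.
move=> ext hn nm; rewrite -(subnKC nm) addnA.
have hk : (Some @` W) (zh (k + n)%N).
  by apply: natural_extension_tail inv1 ext _ hn; exact: leq_addl.
have := push_tail (m - n)%N ext hk => /(congr1 (omap (iter n (quad c2)) : S -> S)).
by case: (zh (k + n + _)%N) (zh (k + n)%N) hk => [a|] [b|] // _ /=; rewrite iterD.
Qed.

Lemma level_in zh : eventually_in c1 W zh -> (Some @` W) (zh (level W zh)).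
Proof. by move=> [_ [n hn]]; apply: (@xgetPex _ 0%N [set n | (Some @` W) (zh n)]); exists n. Qed.

Lemma push_level zh n k : eventually_in c1 W zh -> (Some @` W) (zh n) ->
  push c2 h W zh k = omap (iter n (quad c2) \o h) (zh (k + n)%N).
Proof.
move=> hz hn; have hl := level_in hz; have [ext _] := hz.
rewrite /push -(push_stable k ext hl (leq_maxl _ n)).
by rewrite -(push_stable k ext hn (leq_maxr (level W zh) _)).
Qed.

Lemma push_in zh : eventually_in c1 W zh -> eventually_in c2 W (push c2 h W zh).
Proof.
move=> hz; have hl := level_in hz; have [ext _] := hz; split.
- move=> k; have hl1 : (Some @` W) (zh (level W zh).+1).
    by apply: natural_extension_tail inv1 ext _ hl.
  rewrite (push_level k hz hl1) /push addSnnS.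
  by case: (zh _) => [z|] //=.
- exists (level W zh); rewrite /push push_tail//.
  by case: hl => z Wz <-; exists (h z) => //; exact: hW.
Qed.

Lemma push_continuous : backward_invariant c2 W -> (forall z, W (quad c1 z) -> nbhs z W) ->
  continuous h -> {within eventually_in c1 W, continuous (push c2 h W)}.
Proof.
move=> inv2 nW ch; apply/subspace_continuousP => zh hz.
(* One index further back, the image of the coordinate is in [W], so [W] is a neighbourhood of the
   coordinate; the same [n] then computes [push] for all nearby orbits. *)
have hl := level_in hz; have [ext _] := hz; set n := (level W zh).+1.
have [z Wz zE] : (Some @` W) (zh n) by apply: natural_extension_tail inv1 ext _ hl.
have Wfz : W (quad c1 z).
  move: (ext (level W zh)); rewrite -/n -zE => /= e.
  by move: hl; rewrite -e => -[w Ww [<-]].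
have hn : (Some @` W) (zh n) by exists z.
apply: ptws_cvg => k.
change ((fun yh : X => push c2 h W yh k) @ within (eventually_in c1 W) (nbhs zh)
  --> (push c2 h W zh k : S)).
rewrite (push_level k hz hn).
have near_eq : \forall yh \near within (eventually_in c1 W) (nbhs zh),
    omap (iter n (quad c2) \o h) (yh (k + n)%N) = push c2 h W yh k.
  rewrite near_withinE.
  have : \forall yh \near zh, (Some @` W) (yh n : S).
    apply: (ptws_proj (k := n)); rewrite -zE.
    exact/one_point_compactification_some_nbhs/nW.
  by apply: filterS => yh hy Ay; rewrite (push_level k Ay hy).
apply: cvg_trans; first exact: near_eq_cvg near_eq.
have [y Wy yE] : (Some @` W) (zh (k + n)%N).
  by apply: natural_extension_tail inv1 ext _ hn; exact: leq_addl.
apply: cvg_within_filter.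
apply: (@continuous_comp _ _ _ (fun yh : X => yh (k + n)%N) (omap (iter n (quad c2) \o h) : S -> S)).
  exact: ptws_proj.
rewrite -yE; apply: omap_continuous.
apply: continuous_comp; first exact: ch.
exact/iter_continuous/quad_continuous.
Qed.

End push.

Lemma push_cancel c1 c2 W h h' zh : backward_invariant c1 W -> backward_invariant c2 W ->
  (forall z, W z -> W (h z)) -> (forall z, W z -> W (h' z)) -> cancel h h' ->
  (forall z, W (quad c1 z) -> quad c2 (h z) = h (quad c1 z)) ->
  (forall z, W (quad c2 z) -> quad c1 (h' z) = h' (quad c2 z)) ->
  eventually_in c1 W zh -> push c1 h' W (push c2 h W zh) = zh.
Proof.
move=> inv1 inv2 hW hW' hK e1 e2 hz; apply/funext => k.
have hz2 := push_in inv1 hW e1 hz; have hl := level_in hz; have [ext _] := hz.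
pose n := maxn (level W zh) (level W (push c2 h W zh)).
have h1 : (Some @` W) (zh n) by apply: natural_extension_tail inv1 ext (leq_maxl _ _) hl.
have h2 : (Some @` W) (push c2 h W zh n).
  by apply: natural_extension_tail inv2 hz2.1 (leq_maxr _ _) (level_in hz2).
rewrite (push_level inv2 e2 k hz2 h2).
have h3 : (Some @` W) (zh (k + n)%N).
  by apply: natural_extension_tail inv1 ext (leq_addl _ _) h1.
have -> : push c2 h W zh (k + n)%N = omap h (zh (k + n)%N) by rewrite /push (push_tail inv1 e1 _ ext h3).
rewrite -[RHS](natural_extension_iter k n ext) iter_quad_sphere.
by case: (zh _) => [z|] //=; rewrite hK.
Qed.

Lemma eventually_in_homeomorphic c1 c2 W h h' :
  (forall z, W (quad c1 z) -> nbhs z W) -> (forall z, W (quad c2 z) -> nbhs z W) ->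
  (forall z, W z -> W (h z)) -> (forall z, W z -> W (h' z)) ->
  cancel h h' -> cancel h' h -> continuous h -> continuous h' ->
  (forall z, W (quad c1 z) -> quad c2 (h z) = h (quad c1 z)) ->
  (forall z, W (quad c2 z) -> quad c1 (h' z) = h' (quad c2 z)) ->
  homeomorphic (eventually_in c1 W) (eventually_in c2 W).
Proof.
move=> n1 n2 hW hW' hK hK' ch ch' e1 e2.
have inv1 : backward_invariant c1 W by move=> z /n1 /nbhs_singleton.
have inv2 : backward_invariant c2 W by move=> z /n2 /nbhs_singleton.
exists (push c2 h W), (push c1 h' W); split.
- by split=> zh; exact: push_in.
- exact: push_continuous.
- exact: push_continuous.
- by move=> zh /set_mem; exact: push_cancel.
- by move=> zh /set_mem; exact: push_cancel.
Qed.

End natural_extensions.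

(** * Connected sets on the sphere and the critical points *)

Section connectedness.
Context {R : realType}.
Local Notation C := (Cplx R).
Local Notation S := (sphere R).
Implicit Types (c z w : C) (phi : C -> C).

Lemma connected_between (T : topologicalType) (A B : set T) :
  connected A -> A `<=` B -> B `<=` closure A -> connected B.
Proof.
move=> cA AB BA U U0 [C1 oC1 C1E] [C2 cC2 C2E].
have AU : A `&` U = A.
  apply: cA.
  - move: U0; rewrite {1}C1E => -[z [Bz C1z]]; have [] := BA z Bz C1.
      exact: open_nbhs_nbhs.
    by move=> w [Aw C1w]; exists w; split=> //; rewrite C1E; split=> //; exact: AB.
  - by exists C1 => //; rewrite C1E setIA (setIidl AB).
  - by exists C2 => //; rewrite C2E setIA (setIidl AB).
apply/seteqP; split=> x; first by rewrite C1E => -[].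
move=> Bx; rewrite C2E; split=> //.
have : closure A x := BA x Bx.
have AC2 : A `<=` C2 by rewrite -AU C2E => y [_ []].
by move=> /(closureS AC2); rewrite -(closure_id C2).1.
Qed.

Lemma connected_radius phi y : ccont disc phi -> disc y ->
  connected [set (Some (phi (rc t * y)) : S) | t in `[0, 1]%classic].
Proof.
move=> cp yD; apply: connected_continuous_connected.
  by apply/connected_intervalP; exact: interval_is_interval.
apply/subspace_continuousP => t; rewrite /= in_itv /= => /andP[t0 t1] U hU.
have {}hU : nbhs (phi (rc t * y)) (Some @^-1` U) by [].
have [e e0 he] := (nbhs_nm _ _).1 hU.
have [d d0 hd] := cp _ (disc_scale yD t0 t1) e e0.
rewrite /= nbhs_simpl /= /within /=.
have : nbhs t (ball t d) by exact: nbhsx_ballx.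
apply: filterS => s; rewrite /ball /= distrC => ts; rewrite in_itv /= => /andP[s0 s1].
apply: he; apply: hd; first exact: disc_scale.
rewrite -mulrBl -rcN -rcD nmM nm_rc; apply: le_lt_trans ts.
by rewrite ler_piMr.
Qed.

Lemma connected_disc_image phi : ccont disc phi ->
  connected [set (Some (phi y) : S) | y in disc].
Proof.
move=> cp.
have -> : [set (Some (phi y) : S) | y in disc] =
    \bigcup_(y in disc) [set (Some (phi (rc t * y)) : S) | t in `[0, 1]%classic].
  apply/seteqP; split=> [_ [y yD <-]|x [y yD [t]]].
    exists y => //; exists 1; first by rewrite /= in_itv /= ler01 lexx.
    by rewrite rc1 mul1r.
  rewrite /= in_itv /= => /andP[t0 t1] <-.
  by exists (rc t * y) => //; exact: disc_scale.
apply: bigcup_connected; last by move=> y yD; exact: connected_radius.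
exists (Some (phi 0)) => y yD; exists 0; first by rewrite /= in_itv /= ler01 lexx.
by rewrite rc0 mul0r.
Qed.

Lemma some_connected_image (g : S -> S) (A : set S) : connected A ->
  (forall x, A x -> {for x, continuous g}) -> connected (g @` A).
Proof.
move=> cA hg; apply: connected_continuous_connected => //.
apply/subspace_continuousP => x Ax; apply: cvg_within_filter; exact: hg.
Qed.

Lemma open_some (P : C -> Prop) :
  (forall z, P z -> exists2 e : R, 0 < e & forall y, nm (y - z) < e -> P y) ->
  open (Some @` [set z | P z] : set S).
Proof. by move=> h; apply: one_point_compactification_open_some; apply/open_nm. Qed.

Lemma connected_ball z (d : R) : 0 < d -> connected (Some @` [set w | nm (w - z) < d] : set S).
Proof.
move=> d0.
have -> : Some @` [set w | nm (w - z) < d] =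
    \bigcup_(r in [set r : R | 0 <= r < d]) [set (Some (z + rc r * y) : S) | y in disc].
  apply/seteqP; split=> [_ [w /= wz <-]|_ [r /= /andP[r0 rd] [y yD <-]]].
    exists (nm (w - z)); first by rewrite /= nm_ge0.
    have [e|n0] := eqVneq (w - z) 0.
      exists 0; first exact: disc0.
      by rewrite mulr0 addr0 -[w](subrK z) e add0r.
    have n1 : rc (nm (w - z)) != 0 :> C by rewrite -nm_eq0 nm_rc normr_eq0 nm_eq0.
    exists ((w - z) / rc (nm (w - z))).
      rewrite /disc /= nmM nmV nm_rc ger0_norm ?nm_ge0// divff ?nm_eq0//.
    by rewrite mulrC divfK// addrC subrK.
  exists (z + rc r * y) => //=.
  rewrite addrC addKr nmM nm_rc ger0_norm//; apply: le_lt_trans rd.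
  by rewrite ler_piMr.
apply: bigcup_connected; last first.
  move=> r _; apply: (@connected_disc_image (fun y => z + rc r * y)).
  exact/analytic_ccont/analytic_affine.
exists (Some z) => r _; exists 0; first exact: disc0.
by rewrite mulr0 addr0.
Qed.

Lemma derive1_unique (g : C -> C) a l :
  (forall e : R, 0 < e -> exists2 d : R, 0 < d &
    forall w, w != 0 -> nm w < d -> nm ((g (w + a) - g a) / w - l) < e) ->
  derive1 (g : complex R -> C) a = l.
Proof.
move=> h; rewrite /derive1; apply: cvg_lim; first exact: norm_hausdorff.
move=> U /nbhs_nm[e e0 he]; have [d d0 hd] := h e e0.
rewrite /= nbhs_simpl /=; apply/nbhs_nm; exists d => // w wd w0; apply: he.
have := hd w w0; rewrite subr0 in wd; move=> /(_ wd).
by rewrite mulrC.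
Qed.

Lemma derive1_quad c z : derive1 (quad c : complex R -> C) z = 2 * z.
Proof.
apply: derive1_unique => e e0; exists e => // w w0 we.
have -> : (quad c (w + z) - quad c z) / w - 2 * z = w by rewrite /quad; field.
exact: we.
Qed.

Lemma critical_point_some c z : critical_point c (Some z) <-> z = 0.
Proof.
rewrite /critical_point derive1_quad; split=> [/eqP|->]; last by rewrite mulr0.
by rewrite mulf_eq0 pnatr_eq0 => /eqP.
Qed.

(** In the chart at infinity the map is [w ^+ 2 / (1 + c * w ^+ 2)] near 0. *)
Lemma critical_point_none c : critical_point c None.
Proof.
apply: derive1_unique => e e0.
have c1 : 0 < 1 + nm c by have := nm_ge0 c; lra.
have e2 : 0 < e / 2 by lra.
have [d [d0 d1 d2 d3]] := small3 ltr01 e2 (divr_gt0 ltr01 (mulr_gt0 (ltr0Sn R 1) c1)).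
exists d => // w w0 wd.
have w1 := nm_ge0 w.
rewrite ler_pdivlMr in d3; last exact: mulr_gt0.
have h1 : nm (c * w ^+ 2) <= 1 / 2.
  rewrite nmM nmX; have : nm w ^+ 2 <= nm w by rewrite expr2; nra.
  by have := nm_ge0 c; nra.
have h2 : 1 / 2 <= nm (1 + c * w ^+ 2).
  by have := nmB_ge 1 (- (c * w ^+ 2)); rewrite opprK nmN nm1; lra.
have h3 : 1 + c * w ^+ 2 != 0 by rewrite -nm_gt0; lra.
have q0 : quad_at_infinity c 0 = 0 by rewrite /quad_at_infinity /= eqxx.
have qw : quad_at_infinity c w = w ^+ 2 / (1 + c * w ^+ 2).
  rewrite /quad_at_infinity /= (negbTE w0) /= /quad.
  have E : w^-1 ^+ 2 + c = (1 + c * w ^+ 2) / w ^+ 2 by field.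
  have n0 : w^-1 ^+ 2 + c != 0 by rewrite E mulf_neq0// invr_eq0 expf_neq0.
  by rewrite ifN// /= E; field; rewrite h3.
rewrite addr0 q0 qw !subr0.
have -> : w ^+ 2 / (1 + c * w ^+ 2) / w = w / (1 + c * w ^+ 2) by field; rewrite h3.
rewrite nmM nmV ltr_pdivrMr; last lra.
have : e / 2 <= e * nm (1 + c * w ^+ 2) by have := ler_wpM2l (ltW e0) h2; lra.
lra.
Qed.

End connectedness.

(** * Regular points as backward orbits that enter the trapped region *)

Section regular_points.
Context {R : realType}.
Local Notation C := (Cplx R).
Local Notation S := (sphere R).
Local Notation X := {ptws nat -> sphere R}.
Implicit Types (c z w x : C) (W : set C) (zh : X) (phi : C -> C).

(** On the circle [nm (w - x) = r] the image is at distance [r * nm (w + x)], at least [r ^+ 2],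
    from [quad c x], because [x] is 0 or has modulus at least [r]. A connected set mapped closer
    than that cannot cross the circle. *)
Lemma preimage_component_step c x (e : R) : 0 < e -> exists2 d : R, 0 < d &
  forall A : set S, connected A -> A (Some x) ->
    (forall y, A y -> exists2 w, y = Some w & nm (quad c w - quad c x) < d) ->
    forall y, A y -> exists2 w, y = Some w & nm (w - x) < e.
Proof.
move=> e0.
have [r [r0 re rx]] : exists r, [/\ 0 < r, r <= e & x = 0 \/ r <= nm x].
  have [->|x0] := eqVneq x 0; first by exists e; split=> //; left.
  have nx : 0 < nm x by rewrite nm_gt0.
  by have [r [r0 r1 r2]] := small2 e0 nx; exists r; split=> //; right.
exists (r ^+ 2); first exact: exprn_gt0.
move=> A cA Ax hA.
pose O1 := Some @` [set w | nm (w - x) < r] : set S.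
pose O2 := Some @` [set w | r < nm (w - x)] : set S.
have oO1 : open O1.
  apply: open_some => z zr; exists (r - nm (z - x)); first by lra.
  by move=> y hy; have := nm_triangle z y x; lra.
have oO2 : open O2.
  apply: open_some => z zr; exists (nm (z - x) - r); first by lra.
  by move=> y hy; have := nm_triangle y z x; rewrite (nmB z y); lra.
have cover y : A y -> O1 y \/ O2 y.
  move=> /hA[w -> hw].
  have qE : quad c w - quad c x = (w - x) * (w + x) by rewrite /quad; ring.
  rewrite qE nmM in hw.
  have [h|h|h] := ltgtP (nm (w - x)) r; [by left; exists w|by right; exists w|].
  exfalso; rewrite h expr2 ltr_pM2l// in hw.
  case: rx => [x0|rx]; first by move: hw h; rewrite x0 addr0 subr0; lra.
  have := nmB_ge (2 * x) (x - w).
  have -> : 2 * x - (x - w) = w + x by ring.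
  rewrite (nmB x w) h nmM -(rc_nat 2) nm_rc ger0_norm//; lra.
have disj y : O1 y -> O2 y -> False.
  by move=> [w /= h1 <-] [w' /= h2 [e']]; move: h2; rewrite e'; lra.
have AE : A `&` O1 = A.
  apply: cA.
  - by exists (Some x); split=> //; exists x => //=; rewrite subrr nm0.
  - by exists O1.
  - exists (~` O2); first exact: open_closedC.
    apply/seteqP; split=> y [Ay hy]; split=> //; first by move=> /(disj _ hy).
    by have [|] := cover y Ay.
move=> y Ay; have [_ [w /= h <-]] : (A `&` O1) y by rewrite AE.
by exists w => //; lra.
Qed.

Lemma preimage_component_small c N x (e : R) : 0 < e -> exists2 d : R, 0 < d &
  forall A : set S, connected A -> A (Some x) ->
    (forall y, A y -> exists2 w, iter N (quad_sphere c) y = Some w &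
       nm (w - iter N (quad c) x) < d) ->
    forall y, A y -> exists2 w, y = Some w & nm (w - x) < e.
Proof.
elim: N x e => [|N IH] x e e0; first by exists e.
have [d1 d10 h1] := preimage_component_step c x e0.
have [d d0 h] := IH (quad c x) d1 d10; exists d => // A cA Ax hA.
have Asome y : A y -> exists w, y = Some w.
  by move=> /hA[w]; rewrite iter_quad_sphere; case: y => // v _ _; exists v.
apply: h1 => // y Ay.
have cfA : connected (quad_sphere c @` A).
  apply: some_connected_image => // _ /Asome[w ->].
  by rewrite quad_sphereE; apply: omap_continuous; exact: quad_continuous.
have [|||w] := h _ cfA _ _ (quad_sphere c y).
- by exists (Some x).
- by move=> _ [v Av <-]; rewrite -!iterSr; exact: hA.
- by exists y.
by have [v ->] := Asome y Ay; move=> [<-] hw; exists v.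
Qed.

(** For a small enough [U0] the pullback of index [N] stays in a disc inside [W]; every later
    pullback maps into such a disc, hence lies in [W] by backward invariance and misses 0. It misses
    infinity because [U0] does. *)
Lemma eventually_in_regular c W (eta : R) : 0 < eta -> backward_invariant c W -> ~ W 0 ->
  (forall x, W (quad c x) -> forall y, nm (y - x) <= eta -> W y) ->
  eventually_in c W `<=` regular_part c.
Proof.
move=> eta0 inv W0 inner zh hz; have [ext [n0 hn0]] := hz; split=> //.
(* The extra step puts the image of [z] in [W], which provides the disc of radius [eta] about
   [z]. *)
set N := n0.+1.
have [z Wz zE] : (Some @` W) (zh N) by apply: natural_extension_tail inv ext _ hn0.
have Wfz : W (quad c z).
  by move: (ext n0); rewrite -/N -zE => /= e; move: hn0; rewrite -e => -[w Ww [<-]].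
have [d d0 hd] := preimage_component_small c N z eta0.
pose z0 := iter N (quad c) z.
have z0E : zh 0%N = Some z0.
  by rewrite -(natural_extension_iter 0 N ext) add0n -zE iter_quad_sphere.
pose U0 := Some @` [set w | nm (w - z0) < d] : set S.
exists U0; split.
- apply: open_some => w wr; exists (d - nm (w - z0)); first by lra.
  by move=> y hy; have := nm_triangle w y z0; lra.
- exact: connected_ball.
- by rewrite z0E; exists z0 => //=; rewrite subrr nm0.
exists N => n Nn x Px.
set P := pullback c U0 zh n in Px.
have Psub y : P y -> U0 (iter n (quad_sphere c) y) by exact: connected_component_sub.
have Pz : P (zh n).
  apply: connected_component_refl.
  by rewrite /preimage /= -[n]add0n natural_extension_iter// z0E; exists z0 => //=; rewrite subrr nm0.
have Psome y : P y -> exists w, y = Some w.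
  by move=> /Psub[w _]; rewrite iter_quad_sphere; case: y => // v _; exists v.
have cP : connected P by exact: component_connected.
have cA : connected (iter (n - N) (quad_sphere c) @` P).
  apply: some_connected_image => // _ /Psome[w ->].
  have -> : iter (n - N) (quad_sphere c) = omap (iter (n - N) (quad c)) :> (S -> S).
    by apply/funext => y; exact: iter_quad_sphere.
  by apply: omap_continuous; apply: iter_continuous; exact: quad_continuous.
have [|||w wE hw] := hd _ cA _ _ (iter (n - N) (quad_sphere c) x).
- by exists (zh n) => //; rewrite -{2}(subnKC Nn) natural_extension_iter.
- move=> _ [y Py <-]; rewrite -iterD subnKC//.
  by have [v hv <-] := Psub y Py; exists v.
- by exists x.
have Ww : W w by apply: (inner z) => //; exact: ltW.
have [v xE] := Psome x Px; rewrite xE => /critical_point_some v0.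
move: wE; rewrite xE iter_quad_sphere => -[wE]; apply: W0; rewrite -v0.
have : W (iter (n - N) (quad c) v) by rewrite wE.
by elim: (n - N)%N => [|m IH] //= /inv.
Qed.

(* If a lift of a disc would run through the critical value [c], follow the
   radius towards the first hit: the lifted path tends to the critical point. *)
Lemma zero_in_lifted_component c phi w (P : set S) : analytic_disc phi ->
  quad c w = phi 0 -> (exists2 y, disc y & phi y = c) ->
  (forall y v, disc y -> quad c v = phi y -> P (Some v)) ->
  connected_component P (Some w) (Some 0).
Proof.
move=> hphi wE [y0 y0D y0E] hP.
have cphi := analytic_ccont hphi.
pose K := [set y : C | disc y /\ phi y = c].
have cK : seq_compact K.
  move=> u hu; have [l lD hl] := disc1_compact (fun n => (hu n).1).
  exists l => //; split=> //; apply: nm_le_eq => e e0.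
  have [d d0 hd] := cphi l lD e e0; have [n _ /(hd _ (hu n).1)] := hl d d0 0%N.
  by rewrite (hu n).2 nmB => /ltW.
have [y [yD yE] ymin] := rcont_min cK (ccont_nm (@ccont_id R K)) (ex_intro _ y0 (conj y0D y0E)).
have [yy0|yn0] := eqVneq y 0.
  have w0 : w = 0.
    move: wE; rewrite -yy0 yE /quad -{2}[c]add0r => /addIr /eqP.
    by rewrite expf_eq0 /= => /eqP ->; rewrite yy0.
  by rewrite w0; apply: connected_component_refl; apply: (hP y) => //; rewrite yE -w0 wE -yy0.
have ny : 0 < nm y by rewrite nm_gt0.
have tyD t : 0 <= t -> t <= 1 -> disc (rc t * y) by move=> t0 t1; exact: disc_scale.
(* By minimality of [y] the shrunken discs avoid [c] and lift. Their lifts share the centre [w], so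
   the union is connected, and as [t] tends to 1 the lift at [1] tends to 0, because its square is
   [phi (rc t * y) - c]. *)
have lifts t : 0 <= t < 1 -> exists psi, [/\ analytic_disc psi, psi 0 = w &
    forall u, disc u -> quad c (psi u) = phi (rc t * y * u)].
  move=> /andP[t0 t1].
  have h1 := analytic_scale (tyD _ t0 (ltW t1)) hphi.
  have h2 u : disc u -> phi (rc t * y * u) != c.
    move=> uD; apply/eqP => e; have := ymin (rc t * y * u) (conj (disc_mul (tyD _ t0 (ltW t1)) uD) e).
    rewrite !nmM nm_rc ger0_norm//; move: uD; rewrite /disc /= => uD.
    have h3 : t * nm y * nm u <= t * nm y by rewrite ler_piMr// mulr_ge0// ltW.
    have : t * nm y < nm y by rewrite gtr_pMl.
    lra.
  have [|psi [k1 k2 k3 _]] := disc_lift h1 h2 (a := w); first by rewrite mulr0.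
  by exists psi; split.
have /choice[psi hpsi] t : exists psi, 0 <= t < 1 -> [/\ analytic_disc psi, psi 0 = w &
    forall u, disc u -> quad c (psi u) = phi (rc t * y * u)].
  have [/lifts[psi h]|h] := boolP (0 <= t < 1); first by exists psi.
  by exists id.
pose A := \bigcup_(t in [set t : R | 0 <= t < 1]) [set (Some (psi t u) : S) | u in disc].
have cA : connected A.
  apply: bigcup_connected; last by move=> t /hpsi[h _ _]; exact/connected_disc_image/analytic_ccont.
  by exists (Some w) => t /hpsi[_ h _]; exists 0; [exact: disc0 | rewrite h].
have Aw : A (Some w).
  have t01 : 0 <= (0 : R) < 1 by rewrite lexx ltr01.
  by exists 0 => //; exists 0; [exact: disc0 | have [_ -> _] := hpsi _ t01].
have cl : closure A (Some 0).
  move=> V hV; have {}hV : nbhs (0 : C) (Some @^-1` V) by [].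
  have [e e0 he] := (nbhs_nm _ _).1 hV.
  have [d d0 hd] := cphi y yD _ (exprn_gt0 2 e0).
  have d2 : 0 < d / 2 by lra.
  have [s [s0 s1 sd]] := small2 ltr01 d2.
  have t01 : 0 <= 1 - s < 1 by apply/andP; split; lra.
  have [h1 h2 h3] := hpsi _ t01.
  have oneD : disc (1 : C) by have h : nm (1 : C) <= 1 by rewrite nm1.
  exists (Some (psi (1 - s) 1)); split; first by exists (1 - s) => //; exists 1.
  apply: he; rewrite subr0.
  have h4 := h3 1 oneD; rewrite mulr1 in h4.
  have h5 : nm (psi (1 - s) 1) ^+ 2 < e ^+ 2.
    rewrite -nmX; have -> : psi (1 - s) 1 ^+ 2 = phi (rc (1 - s) * y) - phi y.
      by rewrite -h4 yE /quad addrK.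
    apply: hd; first by apply: tyD; lra.
    have -> : rc (1 - s) * y - y = - (rc s * y) by rewrite rcD rcN rc1; ring.
    rewrite nmN nmM nm_rc ger0_norm ?ltW//; move: yD; rewrite /disc /= => yD.
    have : s * nm y <= s by rewrite ler_piMr// ltW.
    lra.
  by rewrite -(@ltr_pXn2r _ 2%N) ?nnegrE ?nm_ge0// ltW.
have cA0 : connected (A `|` [set (Some 0 : S)]).
  apply: connected_between cA _ _; first exact: subsetUl.
  by move=> v [/subset_closure|->].
apply: (connected_component_max _ _ cA0); [by left| |by right].
move=> v [[t t01 [u uD <-]]|->].
  have [h1 h2 h3] := hpsi _ t01; apply: (hP (rc t * y * u)); last exact: h3.
  by case/andP: t01 => t0 t1; apply: disc_mul => //; apply: tyD => //; exact: ltW.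
by apply: (hP y) => //; rewrite yE /quad expr0n add0r.
Qed.

Lemma regular_eventually_in c W :
  (forall z : nat -> C, (forall n, quad c (z n.+1) = z n) -> (forall n, ~ W (z n)) ->
    attracted_backward c z) ->
  regular_part c `<=` eventually_in c W.
Proof.
move=> out zh [ext [U0 [oU0 _ U00 [N hN]]]]; split=> //; apply: contrapT => /forallNP nW.
have Urefl n : (iter n (quad_sphere c) @^-1` U0) (zh n).
  by rewrite /preimage /= -[n]add0n natural_extension_iter.
have fin n : exists z, zh n = Some z.
  (* A coordinate at infinity forces all later ones to be infinity, a critical point of every later
     pullback. *)
  case zE: (zh n) => [z|]; first by exists z.
  have none m : zh (n + m)%N = None.
    elim: m => [|m IH]; first by rewrite addn0.
    by have := ext (n + m)%N; rewrite -addnS IH; case: (zh _).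
  exfalso; apply: (hN (n + N)%N (leq_addl _ _) (zh (n + N)%N)).
    exact/connected_component_refl/Urefl.
  rewrite none; exact: critical_point_none.
have /choice[z zE] := fin.
have hz n : quad c (z n.+1) = z n by have := ext n; rewrite !zE => -[].
have [j [p [al [p0 hal mal]]]] : attracted_backward c z.
  by apply: out => // n Wn; apply: (nW n); exists (z n).
(* An index past [N] at which the orbit is at [al]. *)
pose m := (j + p * N)%N.
have mN : (N <= m)%N by rewrite /m; apply: leq_trans (leq_addl _ _); exact: leq_pmull.
have [r r0 hr] : exists2 r : R, 0 < r & forall y, nm (y - z m) <= r ->
    U0 (iter m (quad_sphere c) (Some y)).
  have : nbhs (Some (z m) : S) (iter m (quad_sphere c) @^-1` U0).
    have cm : {for (Some (z m) : S), continuous (iter m (quad_sphere c))}.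
      have -> : iter m (quad_sphere c) = omap (iter m (quad c)) :> (S -> S).
        by apply/funext => y; exact: iter_quad_sphere.
      by apply: omap_continuous; apply: iter_continuous; exact: quad_continuous.
    apply: cm; apply: open_nbhs_nbhs; split=> //; rewrite -zE; exact: Urefl.
  move=> h; have {}h : nbhs (z m) (Some @^-1` (iter m (quad_sphere c) @^-1` U0)) by [].
  have [e e0 he] := (nbhs_nm _ _).1 h.
  by exists (e / 2); [lra | move=> y hy; apply: he; lra].
have hz' n : quad c (z (m + n.+1)%N) = z (m + n)%N by rewrite addnS hz.
have hal' n : z (m + p * n)%N = al by rewrite /m -addnA -mulnDr hal.
have [n [phi [h1 h2 h3 h4]]] := backward_hits_critical_value (z := fun n => z (m + n)%N) hz' hal' mal r0.
(* The disc about [z (m + n)] contains the critical value, so the pullback one index further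
   contains 0. *)
apply: (hN (m + n.+1)%N (leq_trans mN (leq_addr _ _)) (Some 0)); last exact/critical_point_some.
rewrite /pullback zE; apply: zero_in_lifted_component h1 _ h4 _; first by rewrite h2 hz'.
move=> y v yD vE; rewrite /preimage /= addnS addnC iterSr [quad_sphere c _]/= vE addnC iterD.
rewrite [iter n _ _]iter_quad_sphere /= h3//; apply: hr.
have -> : z m = al by rewrite -(hal' 0%N) muln0 addn0.
rewrite addrC addKr nmM nm_rc ger0_norm ?(ltW r0)//.
by apply: ler_piMr => //; exact: ltW.
Qed.

End regular_points.

(** * Symmetry and transitivity of homeomorphism *)

Section homeomorphic.
Variables (T U V : topologicalType).
Implicit Types (A : set T) (B : set U) (D : set V).

Lemma homeomorphic_sym A B : homeomorphic A B -> homeomorphic B A.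
Proof. by move=> [f [g [[fAB gBA] cf cg fK gK]]]; exists g, f; split. Qed.

Lemma within_continuous_trans A B (f : T -> U) (g : U -> V) : set_fun A B f ->
  {within A, continuous f} -> {within B, continuous g} -> {within A, continuous (g \o f)}.
Proof.
move=> fAB /subspace_continuousP cf /subspace_continuousP cg.
apply/subspace_continuousP => x Ax W hW.
have /cf : A x := Ax; move=> /(_ _ (cg _ (fAB _ Ax) W hW)).
rewrite /= !nbhs_simpl /= /within /=; apply: filterS => y hy Ay.
by apply: hy => //; exact: fAB.
Qed.

End homeomorphic.

Lemma homeomorphic_trans (T U V : topologicalType) (A : set T) (B : set U) (D : set V) :
  homeomorphic A B -> homeomorphic B D -> homeomorphic A D.
Proof.
move=> [f [g [[fAB gBA] cf cg fK gK]]] [f' [g' [[fBD gDB] cf' cg' fK' gK']]].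
exists (f' \o f), (g \o g'); split.
- by split=> x h /=; [exact/fBD/fAB | exact/gBA/gDB].
- exact: within_continuous_trans cf cf'.
- exact: within_continuous_trans cg' cg.
- move=> x /[dup] /set_mem Ax xA /=; rewrite fK'; first exact: fK.
  exact/mem_set/fAB.
- move=> x /[dup] /set_mem Dx xD /=; rewrite gK; first exact: gK'.
  exact/mem_set/gDB.
Qed.

(** * Local constancy of the regular part and conclusion by connectedness *)

Section hyperbolic_parameters.
Context {R : realType}.
Implicit Types (c z : Cplx R).

Lemma derive1_iter_quad c p z :
  derive1 (iter p (quad c) : complex R -> Cplx R) z = multiplier c p z z.
Proof.
apply: derive1_unique => e e0.
have B0 : 0 <= 1 + nm c + nm z by have := nm_ge0 c; have := nm_ge0 z; lra.
have [L L0 hL] := multiplier_lip p B0.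
have [d [d0 d1 de]] := small2 ltr01 (divr_gt0 e0 L0); exists d => // w w0 wd.
have cB : nm c <= 1 + nm c + nm z by have := nm_ge0 z; lra.
have zB : nm z <= 1 + nm c + nm z by have := nm_ge0 c; lra.
have wB : nm (w + z) <= 1 + nm c + nm z by have := nmD w z; have := nm_ge0 c; lra.
have -> : (iter p (quad c) (w + z) - iter p (quad c) z) / w = multiplier c p (w + z) z.
  by rewrite iter_quadB addrK mulrC mulrA mulVf// mul1r.
have [h _] := hL _ _ _ _ _ _ cB cB zB wB zB zB.
apply: le_lt_trans h _; rewrite addrK !subrr nm0 !addr0 mulrC -ltr_pdivlMr//; lra.
Qed.

Lemma attracting_cycle_trap c : has_attracting_cycle c ->
  exists W B eta eta0 d0, trap c W B eta eta0 d0.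
Proof.
move=> [p [z [p0 pz]]]; rewrite derive1_iter_quad => h.
apply: trap_exists p0 pz _; rewrite -ltcR.
rewrite -[_%:C%C]/(rc _) -normr_nm; exact: h.
Qed.

(** The same [W] describes the regular parts of all nearby parameters, so they can be compared by a
    map that preserves [W]. *)
Lemma trap_regular_part c W (B eta eta0 d0 : R) c1 : trap c W B eta eta0 d0 ->
  nm (c1 - c) <= d0 -> regular_part c1 = eventually_in c1 W.
Proof.
move=> tr h; have inner x : W (quad c1 x) -> forall y, nm (y - x) <= eta -> W y.
  move=> Wx; apply: (trap_inner tr Wx).
  have -> : quad c x - quad c1 x = - (c1 - c) by rewrite /quad; ring.
  by rewrite nmN.
apply/seteqP; split.
- by apply: regular_eventually_in => z; exact: (trap_out tr).
- apply: (eventually_in_regular (trap_eta tr) _ _ inner).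
    by move=> z /inner; apply; rewrite subrr nm0 ltW// (trap_eta tr).
  by move=> /(trap_crit tr); rewrite nm0; have := trap_eta0 tr; lra.
Qed.

Lemma regular_part_stable c : has_attracting_cycle c -> exists2 e : R, 0 < e &
  forall c1, nm (c1 - c) <= e -> homeomorphic (regular_part c) (regular_part c1).
Proof.
move=> /attracting_cycle_trap[W [B [eta [eta0 [d0 tr]]]]].
have [e e0 he] := trap_stable tr; exists e => // c1 /he[hd [h [h' [hK hK' ch ch' hh]]]].
have nbW c2 z : nm (c2 - c) <= d0 -> W (quad c2 z) -> nbhs z W.
  move=> h2 Wz; apply/nbhs_nm; exists eta; first exact: trap_eta tr.
  move=> y yz; apply: (trap_inner tr Wz (x := z)); last exact: ltW.
  have -> : quad c z - quad c2 z = - (c2 - c) by rewrite /quad; ring.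
  by rewrite nmN.
have cc : nm (c - c) <= d0 by rewrite subrr nm0 ltW// (trap_d0 tr).
rewrite (trap_regular_part tr hd) (trap_regular_part tr cc).
apply: (@eventually_in_homeomorphic _ c c1 W h h') => //.
- by move=> z; exact: nbW.
- by move=> z; exact: nbW.
- by move=> z Wz; have [[]] := hh z; auto.
- by move=> z Wz; have [_ []] := hh z; auto.
- exact: ccont_continuous.
- exact: ccont_continuous.
- by move=> z; have [_ _ ? _] := hh z.
- by move=> z; have [_ _ _ ?] := hh z.
Qed.

End hyperbolic_parameters.

Theorem proposition11 (R : realType) (H : set (Cplx R)) (c c0 : Cplx R)
  (hH : hyperbolic_component H) (hc : H c) (hc0 : is_center H c0) :
  homeomorphic (regular_part c) (regular_part c0).
Proof.
have [c' hc' HE] := hH.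
have Hattr z : H z -> has_attracting_cycle z.
  by rewrite HE => /connected_component_sub.
have Hconn : connected H by rewrite HE; exact: component_connected.
pose E := [set z : Cplx R | homeomorphic (regular_part c) (regular_part z)].
have near z : H z -> nbhs z [set y | homeomorphic (regular_part z) (regular_part y)].
  move=> /Hattr/regular_part_stable[e e0 he]; apply/nbhs_nm.
  by exists e => // y yz; apply: he; exact: ltW.
suff HEE : H `&` E = H by have [_] : (H `&` E) c0 by rewrite HEE; exact: hc0.1.
(* [E] is relatively open and relatively closed in [H]: by local constancy, every point of [H] has a
   neighbourhood lying in [E] or in its complement. *)
apply: Hconn.
- exists c; split=> //; have /nbhs_singleton := near _ hc; exact.
- exists (interior E); first exact: open_interior.
  apply/seteqP; split=> z [Hz]; last by move=> /interior_subset.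
  move=> Ez; split=> //; apply: filterS (near _ Hz) => y; exact: homeomorphic_trans Ez.
- exists (~` interior (~` E)); first exact/open_closedC/open_interior.
  apply/seteqP; split=> z [Hz] h; split=> //; first by move=> /interior_subset.
  apply: contrapT => nE; apply: h; apply: filterS (near _ Hz) => y zy Ey.
  by apply: nE; apply: homeomorphic_trans Ey _; exact: homeomorphic_sym.
Qed.
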